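(* Let $d\ge 3$ and let $\{\overline{B}(c_n,r_n)\}_{n\ge 1}$ be a countable collection of non-overlapping (pairwise disjoint) closed balls in $\mathbb{R}^d$ with radii $r_n>0$, such that $\Omega=\mathbb{R}^d\setminus\bigcup_{n\ge 1}\overline{B}(c_n,r_n)$ is a region with $0\in\Omega$. If $$\sum_{n=1}^\infty\left(\frac{r_n}{|c_n|}\right)^{d-2}<\infty,$$ then the collection of balls $\{\overline{B}(c_n,r_n)\}_{n\ge 1}$ is avoidable.
   Context: $\overline{B}(c,r)$ denotes the closed ball in $\mathbb{R}^d$ with centre $c$ and radius $r$. A region is a connected open set. The collection of balls is called avoidable if there is a positive probability that Brownian motion in $\mathbb{R}^d$ started from $0$ never hits any of the balls. *)

(* Defs.v *)
From HB Require Import structures.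
From mathcomp Require Import all_boot all_order all_algebra.
From mathcomp Require Import all_classical all_reals all_analysis.

Set Implicit Arguments.
Unset Strict Implicit.
Unset Printing Implicit Defensive.

Import Order.TTheory GRing.Theory Num.Theory.
Import numFieldNormedType.Exports.

Local Open Scope classical_set_scope.
Local Open Scope ring_scope.

(* R^d is 'rV[R]_d. The library norm on matrices is the maximum norm, hence
   the explicit Euclidean norm; the topology on 'rV[R]_d is the usual one. *)
Definition enorm (R : realType) (d : nat) (x : 'rV[R]_d) : R :=
  Num.sqrt (\sum_(j < d) x ord0 j ^+ 2).

Definition closed_eball (R : realType) (d : nat) (c : 'rV[R]_d) (r : R) :
    set 'rV[R]_d :=
  [set x | enorm (x - c) <= r].

Definition region (R : realType) (d : nat) (U : set 'rV[R]_d) : Prop :=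
  open U /\ connected U.

Definition borel (R : realType) (d : nat) : set (set 'rV[R]_d) :=
  <<s @open 'rV[R]_d >>.

Definition random_vector (R : realType) (d : nat) (disp : measure_display)
    (T : measurableType disp) (X : T -> 'rV[R]_d) : Prop :=
  forall A, borel A -> measurable (X @^-1` A).

(* Product rule for the whole family only: subfamilies are covered by taking
   A i = setT for the remaining indices. *)
Definition independent_vectors (R : realType) (d : nat)
    (disp : measure_display) (T : measurableType disp) (P : probability T R)
    (k : nat) (X : 'I_k -> T -> 'rV[R]_d) : Prop :=
  forall A : 'I_k -> set 'rV[R]_d, (forall i, borel (A i)) ->
    P [set w | forall i, A i (X i w)] = (\prod_(i < k) P (X i @^-1` A i))%E.

(* X has law N(0, sigma^2 I_d), i.e. the d-fold product of N(0, sigma^2); this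
   product measure is determined by its values on measurable boxes. The second
   parameter of normal_prob is the standard deviation. *)
Definition centered_gaussian (R : realType) (d : nat) (disp : measure_display)
    (T : measurableType disp) (P : probability T R) (sigma : R)
    (X : T -> 'rV[R]_d) : Prop :=
  forall A : 'I_d -> set R, (forall j, measurable (A j)) ->
    P [set w | forall j, A j (X w ord0 j)] =
    (\prod_(j < d) normal_prob 0 sigma (A j))%E.

(* Standard Brownian motion in R^d started from 0. Time is restricted to
   [0, +oo[: values of B at negative times are irrelevant. *)
Record brownian_motion (R : realType) (d : nat) (disp : measure_display)
    (T : measurableType disp) (P : probability T R)
    (B : R -> T -> 'rV[R]_d) : Prop := BrownianMotion {
  bm_random_vector : forall t, 0 <= t -> random_vector (B t);
  bm_start : forall w, B 0 w = 0;
  bm_continuous : forall w, {within `[0, +oo[, continuous (fun t => B t w)};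
  bm_independent_increments : forall (k : nat) (t : nat -> R),
    0 <= t 0%N -> {homo t : i j / (i <= j)%N >-> i <= j} ->
    independent_vectors P (fun (i : 'I_k) w => B (t i.+1) w - B (t i) w);
  bm_gaussian_increments : forall s t, 0 <= s -> s < t ->
    centered_gaussian P (Num.sqrt (t - s)) (fun w => B t w - B s w) }.

(* Since all paths are continuous, the event below is measurable; as the law of
   Brownian motion is unique, its probability is the same for every (P, B). *)
Definition avoidable (R : realType) (d : nat) (c : nat -> 'rV[R]_d)
    (r : nat -> R) : Prop :=
  forall (disp : measure_display) (T : measurableType disp)
    (P : probability T R) (B : R -> T -> 'rV[R]_d),
  brownian_motion P B ->
  (0 < P [set w | forall t : R, (0 <= t)%R ->
                  forall n, ~ closed_eball (c n) (r n) (B t w)])%E.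

(* Main.v *)
Require Import Defs.
From HB Require Import structures.
From mathcomp Require Import all_boot all_order all_algebra.
From mathcomp Require Import all_classical all_reals all_analysis.
From mathcomp Require Import measurable_realfun.
From mathcomp Require Import ring lra.

Import Order.TTheory GRing.Theory Num.Theory.
Import numFieldNormedType.Exports.

Local Open Scope classical_set_scope.
Local Open Scope ring_scope.

Set SsrOldRewriteGoalsOrder.
Set Implicit Arguments.
Unset Strict Implicit.
Unset Printing Implicit Defensive.

(** Brownian motion started at [y] ever hits the ball of centre [c] and radius [r]
    with probability at most a constant times [(r / |y - c|) ^ (d - 2)], because a
    multiple of the Newtonian kernel is superharmonic and at least 1 on the ball.
    So if the series of the [(r n / |x - c n|) ^ (d - 2)] is small at a point [x],
    Brownian motion started near [x] avoids all the balls with probability at least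
    1/2 ([hitting_bound]). Such an [x] exists ([exists_small_riesz]): the potential
    of a tail of the series is small at 0 and does not increase in mean along
    Brownian motion, while the finitely many remaining balls are negligible far
    away, where Brownian motion goes.

    It remains to travel from 0 to [x] inside the region. Call a point escapable
    if survival has positive probability, uniformly near this point. Escapable
    points form an open set. They also form a closed set relative to the region
    ([escapable_near]): in a box contained in the region, the probability of going in
    a short time [t] to a given nearby small box is about
    [exp (- m ^ 2 / (2 * t))], much larger than the probability of leaving the big
    box, about [exp (- L ^ 2 / (4 * t))] with [L] much larger than [m]. The region
    being connected, 0 is escapable.

    All this is proved for the random walk [B 0, B h, B (2 * h)] and so on, with
    bounds that do not depend on [h]. Survival is then an iterate of the
    transition operator killed outside the allowed set ([grid_markov]), and the
    probability lost by killing is bounded by any superharmonic function that is at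
    least 1 outside this set ([comparison]). Two such functions are used: a
    Riemann sum of heat kernels over grid times in place of the Newtonian kernel
    ([green]), and the Gaussian [u ^ (- d / 2) * exp (|z| ^ 2 / (2 * u))] with [u]
    decreasing in the number of steps left ([antiheat]). The walk avoids slightly
    enlarged balls, so that continuity of the paths gives the result for all times
    when the mesh tends to 0 ([avoid_of_escapable]). *)

(** * Integration against densities and product laws *)

Section density.
Local Open Scope ereal_scope.
Context d (T : measurableType d) (R : realType).
Variables mu nu : {measure set T -> \bar R}.
Variable g : T -> R.
Hypothesis mg : measurable_fun setT g.
Hypothesis g0 : forall x, (0 <= g x)%R.
Hypothesis nuE : forall A, measurable A -> nu A = \int[mu]_(x in A) (g x)%:E.

Import HBNNSimple.

Lemma ge0_integral_density (f : T -> \bar R) :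
  measurable_fun setT f -> (forall x, 0 <= f x) ->
  \int[nu]_x f x = \int[mu]_x (f x * (g x)%:E).
Proof.
move=> mf f0; pose h := nnsfun_approx measurableT mf.
have fE x : f x = limn (EFin \o h ^~ x).
  by apply/esym/cvg_lim => //; exact: cvg_nnsfun_approx.
have mg' : measurable_fun setT (EFin \o g) by exact/measurable_EFinP.
transitivity (limn (fun n => \int[nu]_x (h n x)%:E)).
  rewrite -monotone_convergence//.
  - by apply: eq_integral => x _; rewrite fE.
  - by move=> n; exact/measurable_EFinP/measurable_funP.
  - by move=> n x _; rewrite lee_fin.
  - by move=> x _ m n mn; rewrite lee_fin; exact/lefP/nd_nnsfun_approx.
transitivity (limn (fun n => \int[mu]_x ((h n x)%:E * (g x)%:E))); last first.
  rewrite -monotone_convergence//.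
  - apply: eq_integral => x _; rewrite fE; apply/cvg_lim => //.
    rewrite -fE; have hc := @cvg_nnsfun_approx _ _ _ _ measurableT _ mf
      (fun x _ => f0 x) x I.
    exact: cvgeZr.
  - by move=> n; apply: emeasurable_funM => //; exact/measurable_EFinP/measurable_funP.
  - by move=> n x _; rewrite mule_ge0 ?lee_fin//.
  - by move=> x _ m n mn; rewrite lee_wpmul2r ?lee_fin//; exact/lefP/nd_nnsfun_approx.
congr (limn _); apply/funext => n.
have hpos y x : 0 <= (y * \1_(h n @^-1` [set y]) x)%:E.
  by have := nnfun_muleindic_ge0 (h n) y x; rewrite -EFinM.
transitivity (\int[nu]_x (\sum_(y \in range (h n))
    (y * \1_(h n @^-1` [set y]) x)%:E)).
  by apply: eq_integral => x _; rewrite fimfunE -fsumEFin.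
rewrite ge0_integral_fsum//; last first.
  by move=> y; exact/measurable_EFinP/measurable_funM.
transitivity (\int[mu]_x (\sum_(y \in range (h n))
    (y * \1_(h n @^-1` [set y]) x)%:E * (g x)%:E)); last first.
  apply: eq_integral => x _.
  rewrite -ge0_mule_fsuml => [|y]; last exact: hpos.
  by rewrite fsumEFin // -(fimfunE _ x).
rewrite ge0_integral_fsum//; last 2 first.
  - move=> y; apply: emeasurable_funM => //.
    exact/measurable_EFinP/measurable_funM.
  - by move=> y x _; rewrite mule_ge0 ?hpos ?lee_fin//.
apply: eq_fsbigr => r; rewrite inE => -[t _ <-].
under eq_integral do rewrite EFinM.
rewrite ge0_integralZl//; try by [exact/measurable_EFinP
  |move=> x _; rewrite lee_fin|rewrite lee_fin].
rewrite integral_indic// setIT nuE//.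
under [RHS]eq_integral do rewrite EFinM -muleA.
rewrite ge0_integralZl//; try by [apply: emeasurable_funM => //; exact/measurable_EFinP
  |move=> x _; rewrite mule_ge0 ?lee_fin|rewrite lee_fin].
congr (_ * _); rewrite [LHS]integral_mkcond; apply: eq_integral => x _.
by rewrite patchE indicE; case: ifPn => _; rewrite ?mul1e ?mul0e.
Qed.

End density.

Section independence_fubini.
Local Open Scope ereal_scope.
Context d d1 d2 (T : measurableType d) (T1 : measurableType d1)
  (T2 : measurableType d2) (R : realType) (P : probability T R).

(** Independence says that the joint law is the product of the two laws, so
    this is Tonelli's theorem for the image measures. *)
Lemma ge0_integral_independent (X : T -> T1) (Y : T -> T2)
    (f : T1 * T2 -> \bar R) :
  measurable_fun setT X -> measurable_fun setT Y ->
  (forall A B, measurable A -> measurable B ->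
    P (X @^-1` A `&` Y @^-1` B) = P (X @^-1` A) * P (Y @^-1` B)) ->
  measurable_fun setT f -> (forall z, 0 <= f z) ->
  \int[P]_w f (X w, Y w) = \int[P]_w \int[P]_w' f (X w, Y w').
Proof.
move=> mX mY XY mf f0.
pose X' := HB.pack_for {mfun T >-> T1} X (isMeasurableFun.Build _ _ _ _ _ mX).
pose Y' := HB.pack_for {mfun T >-> T2} Y (isMeasurableFun.Build _ _ _ _ _ mY).
have mXY : measurable_fun setT (fun w => (X w, Y w)) by exact: measurable_fun_pair.
pose Z := HB.pack_for {mfun T >-> (T1 * T2)%type} (fun w => (X w, Y w))
  (isMeasurableFun.Build _ _ _ _ _ mXY).
pose m1 := distribution P X'; pose m2 := distribution P Y'.
transitivity (\int[distribution P Z]_z f z).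
  by rewrite ge0_integral_distribution.
transitivity (\int[m1 \x m2]_z f z).
  apply: eq_measure_integral => A mA _; apply/esym.
  apply: product_measure_unique => // B C mB mC.
rewrite fubini_tonelli1//.
have mF : measurable_fun setT (fubini_F m2 f).
  exact: measurable_fun_fubini_tonelli_F.
rewrite ge0_integral_distribution//; last first.
  by move=> y; apply: integral_ge0.
apply: eq_integral => w _ /=; rewrite /fubini_F.
rewrite ge0_integral_distribution//.
by apply: measurableT_comp mf _; exact: measurable_pair1.
Qed.

End independence_fubini.

Section past.
Local Open Scope ereal_scope.
Context d d' (T : measurableType d) (S : measurableType d') (R : realType).
Variables (P : probability T R) (n : nat) (X : 'I_n -> T -> S).

Definition mutually_independent := forall A : 'I_n -> set S,
  (forall i, measurable (A i)) ->
  P [set w | forall i, A i (X i w)] = \prod_(i < n) P (X i @^-1` A i).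

(** The rectangles built on the first [k] variables, a pi-system. The
    sigma-algebra it generates is put on [T] itself, so that any function of
    the past can be the first argument in [ge0_integral_independent] without a
    space of finite sequences having to carry a measure. *)
Definition past (k : nat) : set (set T) := [set E |
  exists2 A : 'I_n -> set S, (forall i, measurable (A i)) &
    E = [set w | forall i : 'I_n, (i < k)%N -> A i (X i w)]].

Local Notation past_type k := (g_sigma_algebraType (past k)).

Hypothesis mX : forall i, measurable_fun setT (X i).

Lemma measurable_past_comp k (i : 'I_n) : (i < k)%N ->
  measurable_fun setT (X i : past_type k -> S).
Proof.
move=> ik _ A mA; rewrite setTI; apply: sub_sigma_algebra.
exists (fun j => if j == i then A else setT) => [j|].
  by case: ifP.
apply/seteqP; split=> [w /= Aw j _|w /(_ i ik) /=]; last by rewrite eqxx.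
by case: eqP => // ->.
Qed.

Lemma past_measurable k E : <<s past k >> E -> measurable E.
Proof.
apply: smallest_sub; first exact: sigma_algebra_measurable.
move=> _ [A mA ->].
rewrite (_ : [set w | _] = \bigcap_(i in [set i : 'I_n | (i < k)%N]) (X i @^-1` A i)).
  apply: fin_bigcap_measurable; first exact: finite_finset.
  by move=> i _; rewrite -[X in measurable X]setTI; exact: mX.
by apply/seteqP; split=> w /= + i; apply.
Qed.

Lemma past_setI k : setI_closed (past k).
Proof.
move=> _ _ [A mA ->] [B mB ->]; exists (fun i => A i `&` B i).
  by move=> i; exact: measurableI.
apply/seteqP; split=> w /=; first by move=> [Aw Bw] i ik; split; [exact: Aw|exact: Bw].
by move=> ABw; split=> i ik; have [] := ABw i ik.
Qed.

Lemma past_setT k : past k setT.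
Proof. by exists (fun=> setT) => //; apply/seteqP; split. Qed.

Hypothesis indX : mutually_independent.

Lemma past_rectangle_independent (j : 'I_n) E B : past j E -> measurable B ->
  P (E `&` X j @^-1` B) = P E * P (X j @^-1` B).
Proof.
move=> [A mA ->] mB.
pose A' (i : 'I_n) := if (i < j)%N then A i else setT.
have mA' i : measurable (A' i) by rewrite /A'; case: ifP.
pose AB i := if i == j then B else A' i.
have mAB i : measurable (AB i) by rewrite /AB; case: ifP.
have A'j : A' j = setT by rewrite /A' ltnn.
rewrite (_ : [set w | _] `&` _ = [set w | forall i, AB i (X i w)]); last first.
  apply/seteqP; split=> w /=.
    move=> [Aw Bw] i; rewrite /AB /A'; case: eqP => [->//|_].
    by case: ifPn => // ij; exact: Aw.
  move=> ABw; split=> [i ij|].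
    by have := ABw i; rewrite /AB /A' ij; case: eqP => [eij|//]; move: ij; rewrite eij ltnn.
  by have := ABw j; rewrite /AB eqxx.
rewrite [X in _ = P X * _](_ : _ = [set w | forall i, A' i (X i w)]); last first.
  apply/seteqP; split=> w /=.
    by move=> Aw i; rewrite /A'; case: ifPn => // ij; exact: Aw.
  by move=> Aw i ij; have := Aw i; rewrite /A' ij.
rewrite !indX// (bigD1 j)//= [in RHS](bigD1 j)//= A'j preimage_setT probability_setT mul1e.
rewrite /AB eqxx muleC; congr (_ * _); apply: eq_bigr => i /negbTE ij.
by rewrite ij.
Qed.

(** Both sides are finite measures in [E], and they agree on the pi-system of
    rectangles by the product rule. *)
Lemma past_independent (j : 'I_n) E B : <<s past j >> E -> measurable B ->
  P (E `&` X j @^-1` B) = P E * P (X j @^-1` B).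
Proof.
move=> pE mB.
have mXB : measurable (X j @^-1` B).
  by rewrite -[X in measurable X]setTI; exact: mX.
have XBfin : P (X j @^-1` B) \is a fin_num by exact: fin_num_measure.
pose c : {nonneg R} := NngNum (fine_ge0 (measure_ge0 P (X j @^-1` B))).
have -> : P E * P (X j @^-1` B) = mscale c P E.
  by rewrite /mscale /= fineK// muleC.
rewrite -[LHS]/(mrestr P mXB E).
apply: (g_sigma_algebra_measure_unique (past j) _ (fun=> setT)) => //.
- by move=> F pF; apply: (@past_measurable j); exact: sub_sigma_algebra.
- by move=> _; exact: past_setT.
- by rewrite bigcup_const.
- exact: past_setI.
- move=> F pF; rewrite -[LHS]/(P (F `&` X j @^-1` B)).
  rewrite past_rectangle_independent//.
  by rewrite -[RHS]/((fine (P (X j @^-1` B)))%:E * P F) fineK// muleC.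
- by move=> _; rewrite -[ltLHS]/(P (setT `&` X j @^-1` B)) setTI ltey_eq XBfin.
Qed.

(** Conditioning on the past: the next variable can be integrated out first,
    against an independent copy of itself. *)
Lemma ge0_integral_past_next (j : 'I_n) (f : past_type j * S -> \bar R) :
  measurable_fun setT f -> (forall z, 0 <= f z) ->
  \int[P]_w f (w, X j w) = \int[P]_w \int[P]_w' f (w, X j w').
Proof.
move=> mf f0.
apply: (@ge0_integral_independent _ _ _ T (past_type j) S R P id (X j)) => //.
- move=> _ A mA; rewrite setTI.
  exact: (@past_measurable j).
- by move=> A B mA mB; exact: past_independent.
Qed.

End past.

Section product_expectation.
Local Open Scope ereal_scope.
Context d d' (T : measurableType d) (S : measurableType d') (R : realType).
Variables (P : probability T R) (n : nat) (X : 'I_n -> T -> S).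
Hypothesis mX : forall i, measurable_fun setT (X i).
Hypothesis indX : mutually_independent P X.

(** The factors are integrated out one at a time with
    [ge0_integral_past_next], from the last index to the first. *)
Lemma ge0_integral_prod_independent (f : 'I_n -> S -> R) :
  (forall i, measurable_fun setT (f i)) -> (forall i x, (0 <= f i x)%R) ->
  \int[P]_w (\prod_(i < n) f i (X i w))%:E =
  \prod_(i < n) \int[P]_w (f i (X i w))%:E.
Proof.
move=> mf f0.
suff H k : (k <= n)%N -> \int[P]_w (\prod_(i < n | (i < k)%N) f i (X i w))%:E =
    \prod_(i < n | (i < k)%N) \int[P]_w (f i (X i w))%:E.
  have nE : (fun i : 'I_n => (i < n)%N) =1 xpredT by move=> i; rewrite ltn_ord.
  have := H n (leqnn n); rewrite (eq_bigl _ _ nE) => <-.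
  by apply: eq_integral => w _; rewrite (eq_bigl _ _ nE).
elim: k => [_|k IH kn].
  rewrite big1//; under eq_integral do rewrite big1//.
  rewrite integral_cst// mul1e. exact: probability_setT.
pose j := Ordinal kn.
have jE (i : 'I_n) : ((i < k.+1)%N && (i != j)) = (i < k)%N.
  by rewrite -val_eqE /= ltnS [RHS]ltn_neqAle andbC.
under eq_integral => w _ do rewrite (bigD1 j)//= (eq_bigl _ _ jE).
rewrite (bigD1 j)//= (eq_bigl _ _ jE) -IH; last exact: ltnW.
pose g w := (\prod_(i < n | (i < k)%N) f i (X i w))%R.
have g0 w : (0 <= g w)%R by apply: prodr_ge0.
have mg : measurable_fun setT (g : g_sigma_algebraType (past X k) -> R).
  rewrite /g; under eq_fun do rewrite big_mkcond.
  apply: measurable_prod => i _; case: (ltnP i k) => [ik|_]; last exact: measurable_cst.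
  apply: measurableT_comp => //.
  exact: measurable_past_comp.
have mg' : measurable_fun setT (EFin \o g).
  apply/measurable_EFinP; rewrite /g; under eq_fun do rewrite big_mkcond.
  apply: measurable_prod => i _; case: (ltnP i k) => [ik|_]; last exact: measurable_cst.
  exact: measurableT_comp.
pose h (z : g_sigma_algebraType (past X j) * S) := (f j z.2 * g z.1)%:E.
rewrite (_ : \int[P]_w _ = \int[P]_w h (w, X j w))//.
rewrite (@ge0_integral_past_next _ _ _ _ _ _ _ X)//; last 2 first.
- apply/measurable_EFinP; apply: measurable_funM.
    by apply: measurableT_comp => //; exact: measurable_snd.
  by apply: (measurableT_comp mg); exact: measurable_fst.
- by move=> z; rewrite lee_fin mulr_ge0.
rewrite /h /=.
under eq_integral => w _.
  under eq_integral do rewrite EFinM.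
  rewrite ge0_integralZr//; [|by apply/measurable_EFinP; exact: measurableT_comp
    |by move=> x _; rewrite lee_fin|by rewrite lee_fin].
  over.
rewrite ge0_integralZl//; first by move=> w _; rewrite lee_fin.
by apply: integral_ge0 => w _; rewrite lee_fin.
Qed.

End product_expectation.

(** * Euclidean vectors as a measurable space *)

Section vectors.
Local Open Scope ereal_scope.
Context (R : realType) (d : nat).

(** Measurable boxes are a generating pi-system for which measurability of a
    vector-valued map is measurability of its coordinates; sums of measurable
    maps are then measurable without any appeal to second countability. *)
Definition box_system : set (set 'rV[R]_d) := [set A |
  exists2 B : 'I_d -> set R, (forall j, measurable (B j)) &
    A = [set x : 'rV[R]_d | forall j, B j (x ord0 j)]].

Local Notation V := (g_sigma_algebraType box_system).

Lemma measurable_to_vec d1 (T : measurableType d1) (f : T -> 'rV[R]_d) :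
  (forall j, measurable_fun setT (fun x => f x ord0 j)) ->
  measurable_fun setT (f : T -> V).
Proof.
move=> mf; apply: (@measurability _ _ T V setT f box_system erefl).
move=> _ [_ [B mB ->] <-]; rewrite setTI.
rewrite (_ : _ @^-1` _ = \bigcap_(j in [set: 'I_d]) ((fun x => f x ord0 j) @^-1` B j)).
  apply: fin_bigcap_measurable; first exact: finite_finset.
  by move=> j _; rewrite -[X in measurable X]setTI; exact: mf.
by apply/seteqP; split=> x /= fx j; [move=> _|]; exact: fx.
Qed.

Lemma measurable_coord j : measurable_fun setT (fun x : V => (x : 'rV[R]_d) ord0 j).
Proof.
move=> _ A mA; rewrite setTI; apply: sub_sigma_algebra.
exists (fun i => if i == j then A else setT) => [i|]; first by case: ifP.
apply/seteqP; split=> [x /= Ax i|x /(_ j) /=]; last by rewrite eqxx.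
by case: eqP => // ->.
Qed.

Lemma measurable_vec_coord d1 (T : measurableType d1) (f : T -> V) j :
  measurable_fun setT f -> measurable_fun setT (fun x => (f x : 'rV[R]_d) ord0 j).
Proof. by move=> mf; exact: (measurableT_comp (measurable_coord j) mf). Qed.

Lemma measurable_vecD d1 (T : measurableType d1) (f g : T -> V) :
  measurable_fun setT f -> measurable_fun setT g ->
  measurable_fun setT ((fun x => (f x : 'rV[R]_d) + g x)%R : T -> V).
Proof.
move=> mf mg; apply: measurable_to_vec => j.
under eq_fun do rewrite mxE.
by apply: measurable_funD; exact: measurable_vec_coord.
Qed.

(** Coordinates are continuous, so this sigma-algebra lies inside the Borel
    one; hence the hypotheses on Brownian motion, stated for Borel sets, apply
    to it. *)
Lemma box_system_borel (A : set V) : measurable A -> borel A.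
Proof.
apply: smallest_sub; first exact: smallest_sigma_algebra.
move=> _ [B mB ->].
pose W := g_sigma_algebraType (@open 'rV[R]_d).
have mcoord j : measurable_fun setT (fun x : W => (x : 'rV[R]_d) ord0 j).
  apply: (measurability _ (RGenOpens.measurableE R)).
  move=> _ [_ [a [b ->]] <-]; rewrite setTI; apply: sub_sigma_algebra.
  have oU : open (`]a, b[%classic : set R) by exact: interval_open.
  apply: open_comp oU => x _; exact: coord_continuous.
rewrite -[borel _]/(measurable (_ : set W)).
rewrite (_ : [set x | _] =
    \bigcap_(j in [set: 'I_d]) ((fun x : W => (x : 'rV[R]_d) ord0 j) @^-1` B j)).
  apply: fin_bigcap_measurable; first exact: finite_finset.
  by move=> j _; rewrite -[X in measurable X]setTI; exact: mcoord.
by apply/seteqP; split=> x /= fx j; [move=> _|]; exact: fx.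
Qed.

Lemma random_vector_measurable d1 (T : measurableType d1) (X : T -> 'rV[R]_d) :
  random_vector X -> measurable_fun setT (X : T -> V).
Proof. by move=> rX _ A mA; rewrite setTI; apply: rX; exact: box_system_borel. Qed.

End vectors.

(** * Gaussian integrals of Gaussian functions *)

Section normal_integral.
Local Open Scope ring_scope.
Context (R : realType).
Implicit Types s u a x : R.

(** Completing the square: the product of two Gaussian functions of [x] is a
    multiple of the normal density whose inverse variance is the sum of the
    inverses of [u] and [s]. The condition on [(u + s) / u] allows a negative [u], which gives
    the growing Gaussian used for the parabolic barrier. *)
Lemma normal_gauss_factor s u a x : 0 < s -> u != 0 -> 0 < (u + s) / u ->
  expR (- (a + x) ^+ 2 / (2 * u)) * normal_pdf 0 (Num.sqrt s) x =
  ((Num.sqrt ((u + s) / u))^-1 * expR (- a ^+ 2 / (2 * (u + s)))) *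
    normal_pdf (- a * s / (u + s)) (Num.sqrt (s / ((u + s) / u))) x.
Proof.
move=> s0 u0 us0.
have us : u + s != 0.
  by apply: contraTneq us0 => ->; rewrite mul0r ltxx.
have v0 : 0 < s / ((u + s) / u) by rewrite divr_gt0.
rewrite !normal_pdfE ?gt_eqF ?sqrtr_gt0// /normal_peak /normal_fun.
rewrite !sqr_sqrtr ?ltW//.
have -> : Num.sqrt (s * pi *+ 2) = Num.sqrt ((u + s) / u) *
    Num.sqrt (s / ((u + s) / u) * pi *+ 2).
  rewrite -sqrtrM ?ltW//; congr Num.sqrt.
  move: (@pi R) => p.
  by rewrite mulrnAr mulrA (mulrC _ (s / ((u + s) / u))) divfK// gt_eqF.
rewrite (invfM (Num.sqrt _)).
have expE : expR (- (a + x) ^+ 2 / (2 * u)) * expR (- (x - 0) ^+ 2 / (s *+ 2)) =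
   expR (- a ^+ 2 / (2 * (u + s))) *
   expR (- (x - - a * s / (u + s)) ^+ 2 / (s / ((u + s) / u) *+ 2)).
  rewrite -!expRD; congr expR; rewrite -(mulr_natr s 2) -(mulr_natr (s / _) 2); field.
  by rewrite u0 us gt_eqF.
by rewrite [LHS]mulrCA expE mulrACA.
Qed.

Lemma integral_normal_gauss s u a : 0 < s -> u != 0 -> 0 < (u + s) / u ->
  (\int[normal_prob 0 (Num.sqrt s)]_x (expR (- (a + x) ^+ 2 / (2 * u)))%:E =
  ((Num.sqrt ((u + s) / u))^-1 * expR (- a ^+ 2 / (2 * (u + s))))%:E)%E.
Proof.
move=> s0 u0 us0.
have mexp : measurable_fun setT (fun x : R => (expR (- (a + x) ^+ 2 / (2 * u)))%:E).
  apply/measurable_EFinP; apply: measurableT_comp => //.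
  apply: measurable_funM => //; apply: measurableT_comp => //.
  by apply: measurable_funX; exact: measurable_funD.
rewrite (@ge0_integral_density _ _ _ lebesgue_measure _ (normal_pdf 0 (Num.sqrt s)))//.
- under eq_integral do rewrite -EFinM normal_gauss_factor// EFinM.
  rewrite ge0_integralZl_EFin ?mulr_ge0 ?expR_ge0 ?invr_ge0 ?sqrtr_ge0//.
  + by rewrite integral_normal_pdf mule1.
  + by move=> x _; rewrite lee_fin normal_pdf_ge0.
  + by apply/measurable_EFinP; exact: measurable_normal_pdf.
- exact: measurable_normal_pdf.
- by move=> x; exact: normal_pdf_ge0.
Qed.

End normal_integral.

Section gaussian_vector.
Local Open Scope ring_scope.
Context (R : realType) (d : nat) (disp : measure_display)
  (T : measurableType disp) (P : probability T R).

Local Notation V := (g_sigma_algebraType (@box_system R d)).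

Definition sqnorm (x : 'rV[R]_d) : R := \sum_(j < d) x ord0 j ^+ 2.

Variables (sigma : R) (N : T -> 'rV[R]_d).
Hypothesis mN : measurable_fun setT (N : T -> V).
Hypothesis gN : centered_gaussian P sigma N.

Lemma gaussian_coord j (A : set R) : measurable A ->
  P [set w | A (N w ord0 j)] = normal_prob 0 sigma A.
Proof.
move=> mA; pose B i := if i == j then A else setT.
have := @gN B; rewrite (_ : [set w | _] = [set w | A (N w ord0 j)]); last first.
  apply/seteqP; split=> w /=; first by move=> /(_ j); rewrite /B eqxx.
  by move=> Aw i; rewrite /B; case: eqP => // ->.
move=> ->; last by move=> i; rewrite /B; case: ifP.
rewrite (bigD1 j)//= {1}/B eqxx big1 ?mule1// => i /negbTE ij.
by rewrite /B ij; exact: probability_setT.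
Qed.

Lemma gaussian_coord_independent :
  mutually_independent P (fun (j : 'I_d) w => N w ord0 j).
Proof.
move=> A mA; rewrite gN//; apply: eq_bigr => j _.
by rewrite -(gaussian_coord j).
Qed.

Lemma ge0_integral_gaussian_coord j (f : R -> \bar R) :
  measurable_fun setT f -> (forall x, 0 <= f x)%E ->
  (\int[P]_w f (N w ord0 j) = \int[normal_prob 0 sigma]_x f x)%E.
Proof.
move=> mf f0.
have mNj : measurable_fun setT ((fun w => N w ord0 j) : T -> measurableTypeR R).
  exact: (@measurable_vec_coord R d _ T N j mN).
pose X := HB.pack_for {mfun T >-> measurableTypeR R} (fun w => N w ord0 j)
  (isMeasurableFun.Build _ _ _ _ _ mNj).
rewrite -[LHS]/(\int[P]_w (f \o X) w)%E -ge0_integral_distribution//.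
by apply: eq_measure_integral => A mA _; exact: (gaussian_coord j).
Qed.

End gaussian_vector.

Section gaussian_formula.
Local Open Scope ring_scope.
Context (R : realType) (d : nat) (disp : measure_display)
  (T : measurableType disp) (P : probability T R).
Local Notation V := (g_sigma_algebraType (@box_system R d)).

(** The coordinates are independent and the integrand is a product over them,
    so the one-dimensional formula applies to each factor. *)
Lemma gaussian_shift (N : T -> 'rV[R]_d) (s u : R) (z : 'rV[R]_d) :
  measurable_fun setT (N : T -> V) -> centered_gaussian P (Num.sqrt s) N ->
  0 < s -> u != 0 -> 0 < (u + s) / u ->
  (\int[P]_w (expR (- sqnorm (z + N w) / (2 * u)))%:E =
   ((Num.sqrt ((u + s) / u))^-1 ^+ d * expR (- sqnorm z / (2 * (u + s))))%:E)%E.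
Proof.
move=> mN gN s0 u0 us0.
pose f (j : 'I_d) (x : R) := expR (- (z ord0 j + x) ^+ 2 / (2 * u)).
have mf j : measurable_fun setT (f j).
  apply: measurableT_comp => //; apply: measurable_funM => //.
  apply: measurableT_comp => //; apply: measurable_funX; exact: measurable_funD.
transitivity (\int[P]_w (\prod_(j < d) f j (N w ord0 j))%:E)%E.
  apply: eq_integral => w _; congr EFin; rewrite /f -expR_sum; congr expR.
  rewrite /sqnorm mulNr mulr_suml -sumrN; apply: eq_bigr => j _.
  by rewrite mxE mulNr.
rewrite (@ge0_integral_prod_independent _ _ _ _ _ P d (fun j w => N w ord0 j))//.
- transitivity (\prod_(j < d) ((Num.sqrt ((u + s) / u))^-1 *
      expR (- z ord0 j ^+ 2 / (2 * (u + s))))%:E)%E.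
    apply: eq_bigr => j _.
    rewrite (@ge0_integral_gaussian_coord _ _ _ _ _ (Num.sqrt s) N mN gN j (EFin \o f j))//.
    + exact: integral_normal_gauss.
    + exact/measurable_EFinP.
    + by move=> x; rewrite lee_fin expR_ge0.
  rewrite prodEFin; congr EFin; rewrite big_split/= prodr_const card_ord.
  rewrite -expR_sum; congr (_ * expR _).
  rewrite /sqnorm mulNr mulr_suml -sumrN; apply: eq_bigr => j _.
  by rewrite mulNr.
- by move=> j; exact: measurable_vec_coord.
- exact: (gaussian_coord_independent gN).
- by move=> j x; exact: expR_ge0.
Qed.

Lemma gaussian_law (M N : T -> 'rV[R]_d) (s : R) (f : V -> \bar R) :
  measurable_fun setT (M : T -> V) -> measurable_fun setT (N : T -> V) ->
  centered_gaussian P s M -> centered_gaussian P s N ->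
  measurable_fun setT f -> (forall x, 0 <= f x)%E ->
  (\int[P]_w f (M w) = \int[P]_w f (N w))%E.
Proof.
move=> mM mN gM gN mf f0.
pose X := HB.pack_for {mfun T >-> V} M (isMeasurableFun.Build _ _ _ _ _ mM).
pose Y := HB.pack_for {mfun T >-> V} N (isMeasurableFun.Build _ _ _ _ _ mN).
rewrite -[LHS]/(\int[P]_w (f \o X) w)%E -[RHS]/(\int[P]_w (f \o Y) w)%E.
rewrite -!ge0_integral_distribution//.
apply: eq_measure_integral => A mA _.
apply: (@measure_unique _ _ V (@box_system R d) (fun=> setT)) => //.
- move=> _ _ [B mB ->] [C mC ->]; exists (fun j => B j `&` C j).
    by move=> j; exact: measurableI.
  apply/seteqP; split=> x /=; first by move=> [? ?].
  by move=> h; split=> j; have [] := h j.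
- by move=> _; exists (fun=> setT) => //; apply/seteqP; split.
- by rewrite bigcup_const.
- move=> _ [B mB ->].
  by transitivity (\prod_(j < d) normal_prob 0 s (B j))%E;
    [exact: gM|apply/esym; exact: gN].
- move=> _; apply: (@le_lt_trans _ _ 1%E); last exact: ltry.
  by rewrite -[X in (X <= _)%E]/(P setT); exact: probability_le1.
Qed.

End gaussian_formula.

(** * The heat kernel and the discrete Green function *)

Section heat_kernel.
Local Open Scope ring_scope.
Context (R : realType) (d : nat).
Implicit Types u s h rho : R.

(** The heat kernel at time [u], up to a constant factor, as a function of
    the squared distance [s]. *)
Definition heat u s : R := (Num.sqrt u)^-1 ^+ d * expR (- s / (2 * u)).
(** The heat kernel at time [- u]: it also solves a heat equation, but backwards
    in time, and grows at infinity, so that it can dominate the exit from a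
    large ball. *)
Definition antiheat u s : R := (Num.sqrt u)^-1 ^+ d * expR (s / (2 * u)).

Lemma heat_ge0 u s : 0 <= heat u s.
Proof. by rewrite mulr_ge0 ?expR_ge0 ?exprn_ge0 ?invr_ge0. Qed.

Lemma antiheat_ge0 u s : 0 <= antiheat u s.
Proof. by rewrite mulr_ge0 ?expR_ge0 ?exprn_ge0 ?invr_ge0. Qed.

(** Follows from [1 + y <= expR y] at [y = (1 + x) / (2 * d)], raised to
    the power [d]. *)
Lemma expr1x_expR_le (x : R) : 0 <= x -> (0 < d)%N ->
  (1 + x) ^+ d * expR (- x / 2) <= (2 * d%:R) ^+ d * expR (1 / 2).
Proof.
move=> x0 d0.
have dR : 0 < 2 * d%:R :> R by rewrite mulr_gt0 ?ltr0n.
have H : (1 + x) / (2 * d%:R) <= expR ((1 + x) / (2 * d%:R)).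
  by apply: le_trans (expR_ge1Dx _); rewrite lerDr.
have H1 : (1 + x) ^+ d <= (2 * d%:R) ^+ d * expR ((1 + x) / 2).
  have -> : expR ((1 + x) / 2) = expR ((1 + x) / (2 * d%:R)) ^+ d.
    rewrite -expRM_natl; congr expR; rewrite -mulr_natl; field.
    by rewrite pnatr_eq0 -lt0n.
  rewrite -exprMn lerXn2r ?nnegrE ?(mulr_ge0, expR_ge0, addr_ge0, ltW dR)//.
  by rewrite [leRHS]mulrC -ler_pdivrMr.
apply: (@le_trans _ _ ((2 * d%:R) ^+ d * expR ((1 + x) / 2) * expR (- x / 2))).
  by rewrite ler_wpM2r ?expR_ge0.
rewrite -mulrA -expRD ler_wpM2l ?exprn_ge0 ?(ltW dR)// ler_expR.
by lra.
Qed.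

Definition heat_const : R := (2 * d%:R) ^+ d * expR (1 / 2).

Lemma heat_const_gt0 : (0 < d)%N -> 0 < heat_const.
Proof. by move=> d0; rewrite mulr_gt0 ?expR_gt0 ?exprn_gt0 ?mulr_gt0 ?ltr0n. Qed.

(** The Gaussian factor absorbs any power of [1 + s / u]; the bound obtained is
    monotone in [u] and has no singularity at [u = 0], so it can be summed over
    a grid of times. *)
Lemma heat_le u s : (0 < d)%N -> 0 < u -> 0 <= s ->
  heat u s <= heat_const * (Num.sqrt (u + s))^-1 ^+ d.
Proof.
move=> d0 u0 s0.
have us0 : 0 < u + s by rewrite ltr_wpDr.
have x0 : 0 <= s / u by rewrite divr_ge0// ltW.
have -> : heat u s = (Num.sqrt (u + s))^-1 ^+ d *
    (Num.sqrt (1 + s / u) ^+ d * expR (- (s / u) / 2)).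
  rewrite /heat mulrA -exprMn; congr (_ ^+ _ * expR _).
    rewrite (_ : 1 + s / u = (u + s) / u); last by field; rewrite gt_eqF.
    rewrite sqrtrM ?(ltW us0)// sqrtrV ?(ltW u0)// mulKf// gt_eqF// sqrtr_gt0//.
  by field; rewrite gt_eqF.
rewrite mulrC ler_wpM2r ?exprn_ge0 ?invr_ge0 ?sqrtr_ge0//.
apply: le_trans (expr1x_expR_le x0 d0).
rewrite ler_wpM2r ?expR_ge0// lerXn2r ?nnegrE ?sqrtr_ge0 ?addr_ge0//.
have le1 : 1 <= 1 + s / u by rewrite lerDl.
rewrite -[leRHS]ger0_norm -?sqrtr_sqr; last by rewrite (le_trans ler01).
move: (1 + s / u) le1 => y le1.
by rewrite ler_sqrt; nra.
Qed.

(** The function [v |-> - 2 / sqrt (v + s)] has derivative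
    [(v + s) ^ (- 3 / 2)], which decreases; this compares one term of a Riemann
    sum with an increment of the primitive. *)
Lemma telescoping_cube h s v : 0 < h -> 0 < s -> 0 <= v ->
  h * (Num.sqrt (v + h + s))^-1 ^+ 3 <=
  2 * (Num.sqrt (v + s))^-1 - 2 * (Num.sqrt (v + h + s))^-1.
Proof.
move=> h0 s0 v0.
have b0 : 0 < Num.sqrt (v + s) by rewrite sqrtr_gt0 ltr_wpDl.
have a0 : 0 < Num.sqrt (v + h + s) by rewrite sqrtr_gt0 ltr_wpDl// addr_ge0// ltW.
have ab : Num.sqrt (v + s) <= Num.sqrt (v + h + s).
  by rewrite ler_sqrt; lra.
have hE : h = Num.sqrt (v + h + s) ^+ 2 - Num.sqrt (v + s) ^+ 2.
  by rewrite !sqr_sqrtr; lra.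
move: (Num.sqrt _) (Num.sqrt _) a0 b0 ab hE => b a a0 b0 ab ->.
rewrite -subr_ge0 (_ : _ - _ =
  (a - b) ^+ 2 * (2 * a + b) / (a ^+ 3 * b)); last first.
  by field; rewrite !gt_eqF.
apply: divr_ge0; apply: mulr_ge0; rewrite ?sqr_ge0 ?exprn_ge0//; lra.
Qed.

(** A Riemann sum of mesh [h] for the integral of the heat kernel over all
    times, which is a multiple of the Newtonian kernel. Unlike the integral it
    is superharmonic for the grid walk by a mere shift of the index, and
    two-sided bounds up to constants are all that is needed. *)
Definition green h s : \bar R :=
  (\sum_(0 <= k <oo) (h * heat (h * k.+1%:R) s)%:E)%E.

Lemma green_term_ge0 h s k : 0 < h -> (0 <= (h * heat (h * k.+1%:R) s)%:E)%E.
Proof. by move=> h0; rewrite lee_fin mulr_ge0 ?heat_ge0 ?ltW. Qed.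

Lemma green_ge0 h s : 0 < h -> (0 <= green h s)%E.
Proof. by move=> h0; apply: nneseries_ge0 => k _ _; exact: green_term_ge0. Qed.

(** The dimension enters here: [d >= 3] makes the heat kernel integrable at
    infinity in time. Three of the [d] factors [1 / sqrt (u + s)] are summed by
    telescoping and the other [d - 3] are bounded by [1 / sqrt s]. *)
Lemma green_le h s : (3 <= d)%N -> 0 < h -> 0 < s ->
  (green h s <= (2 * heat_const * (Num.sqrt s)^-1 ^+ (d - 2))%:E)%E.
Proof.
move=> d3 h0 s0.
have d0 : (0 < d)%N by apply: leq_trans d3.
have C0 := heat_const_gt0 d0.
have sq0 : 0 < Num.sqrt s by rewrite sqrtr_gt0.
pose D := heat_const * (Num.sqrt s)^-1 ^+ (d - 3).
have D0 : 0 <= D by rewrite mulr_ge0 ?exprn_ge0 ?invr_ge0 ?ltW.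
pose F k := 2 * (Num.sqrt (h * k%:R + s))^-1.
have tele k : h * heat (h * k.+1%:R) s <= D * (F k - F k.+1).
  have v0 : 0 <= h * k%:R by rewrite mulr_ge0 ?(ltW h0).
  have u0 : 0 < h * k.+1%:R by rewrite mulr_gt0 ?ltr0n.
  have uE : h * k.+1%:R = h * k%:R + h by rewrite -addn1 natrD mulrDr mulr1.
  apply: (@le_trans _ _ (D * (h * (Num.sqrt (h * k.+1%:R + s))^-1 ^+ 3))); last first.
    by rewrite ler_wpM2l// /F uE telescoping_cube.
  rewrite (mulrCA D); apply: ler_wpM2l; first exact: ltW.
  apply: le_trans (heat_le d0 u0 (ltW s0)) _.
  rewrite /D -(mulrA heat_const); apply: ler_wpM2l; first exact: ltW.
  rewrite -[in leLHS](subnK d3) exprD ler_wpM2r ?exprn_ge0 ?invr_ge0 ?sqrtr_ge0//.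
  rewrite lerXn2r ?nnegrE ?invr_ge0 ?sqrtr_ge0// lef_pV2 ?posrE ?sqrtr_gt0 ?addr_gt0//.
  by rewrite ler_sqrt; lra.
apply: lime_le; first by apply: is_cvg_nneseries => k _ _; exact: green_term_ge0.
apply: nearW => n; rewrite sumEFin lee_fin.
apply: (@le_trans _ _ (\sum_(0 <= k < n) D * (F k - F k.+1))).
  by apply: ler_sum => k _; exact: tele.
rewrite -mulr_sumr.
have -> : \sum_(0 <= k < n) (F k - F k.+1) = F 0%N - F n.
  rewrite -opprB -telescope_sumr// -sumrN; apply: eq_bigr => k _.
  by rewrite opprB.
apply: (@le_trans _ _ (D * F 0%N)).
  by rewrite ler_wpM2l// lerBlDr lerDl mulr_ge0 ?invr_ge0 ?sqrtr_ge0.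
rewrite /D /F mulr0 add0r (_ : (d - 2)%N = (d - 3).+1); last by rewrite subnSK.
by rewrite exprSr; rewrite le_eqVlt; apply/orP; left; apply/eqP; ring.
Qed.

(** The grid times between [rho ^ 2] and [4 rho ^ 2] suffice: there are at
    least [rho ^ 2 / h] of them, and the heat kernel is there at least a constant
    times [rho ^ (- d)]. *)
Lemma green_ge h s rho : (2 <= d)%N -> 0 < h -> 0 < rho -> h <= rho ^+ 2 ->
  0 <= s -> s <= (2 * rho) ^+ 2 ->
  ((expR (- 2) / 2 ^+ d * rho^-1 ^+ (d - 2))%:E <= green h s)%E.
Proof.
move=> d2 h0 rho0 hrho s0 srho.
(* For K <= k < 2K the time h * k.+1 lies between rho ^ 2 and 4 rho ^ 2. *)
pose K := (Num.truncn (rho ^+ 2 / h)).+1.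
have q0 : 0 <= rho ^+ 2 / h by rewrite divr_ge0 ?sqr_ge0 ?(ltW h0).
have /andP[q1 q2] := truncn_itv q0.
have K1 : rho ^+ 2 <= h * K%:R.
  by rewrite mulrC -ler_pdivrMr// ltW.
have K2 : h * K%:R <= 2 * rho ^+ 2.
  rewrite /K -addn1 natrD mulrDr mulr1 (mulr_natl _ 2) mulr2n lerD//.
  by rewrite mulrC -ler_pdivlMr.
pose t k := h * heat (h * k.+1%:R) s.
have term k : (K <= k)%N -> (k < K + K)%N ->
    h * ((2 * rho)^-1 ^+ d * expR (- 2)) <= t k.
  move=> Kk kK; rewrite ler_wpM2l ?(ltW h0)//.
  have u1 : rho ^+ 2 <= h * k.+1%:R.
    by apply: le_trans K1 _; rewrite ler_wpM2l ?(ltW h0)// ler_nat (leq_trans Kk).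
  have u2 : h * k.+1%:R <= (2 * rho) ^+ 2.
    apply: (@le_trans _ _ (h * (K + K)%:R)); first by rewrite ler_wpM2l ?(ltW h0)// ler_nat.
    by rewrite natrD mulrDr exprMn; lra.
  have u0 : 0 < h * k.+1%:R by rewrite mulr_gt0 ?ltr0n.
  rewrite /heat ler_pM ?(exprn_ge0, invr_ge0, expR_ge0, mulr_ge0, ltW rho0)//.
    rewrite lerXn2r ?nnegrE ?(invr_ge0, sqrtr_ge0, mulr_ge0, ltW rho0)//.
    rewrite lef_pV2 ?posrE ?sqrtr_gt0 ?mulr_gt0//.
    rewrite -[leRHS]ger0_norm ?(mulr_ge0, ltW rho0)// -sqrtr_sqr ler_sqrt// ?exprn_gt0 ?mulr_gt0//.
    exact: sqr_ge0.
  rewrite ler_expR mulNr lerN2 ler_pdivrMr ?mulr_gt0//.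
  by apply: le_trans srho _; rewrite exprMn; lra.
have tE : (\sum_(0 <= k < K + K) (t k)%:E <= green h s)%E.
  by apply: nneseries_lim_ge => k _ _; exact: green_term_ge0.
apply: le_trans tE; rewrite sumEFin lee_fin.
rewrite (@big_cat_nat _ _ _ K)/=; [|by []|by rewrite leq_addr].
rewrite ler_wpDl ?sumr_ge0// => [k _|]; first by rewrite mulr_ge0 ?heat_ge0 ?ltW.
apply: (@le_trans _ _ (\sum_(K <= k < K + K) h * ((2 * rho)^-1 ^+ d * expR (- 2)))).
  rewrite sumr_const_nat addKn -(mulr_natr _ K).
  apply: (@le_trans _ _ (rho ^+ 2 * ((2 * rho)^-1 ^+ d * expR (- 2)))).
    have -> : (2 * rho)^-1 ^+ d = 2^-1 ^+ d * (rho^-1 ^+ (d - 2) * rho^-1 ^+ 2).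
      by rewrite invfM exprMn -exprD subnK.
    rewrite -exprVn; move: (_ ^+ (d - 2)) (2^-1 ^+ d) (expR _) => x y z.
    rewrite le_eqVlt; apply/orP; left; apply/eqP; field.
    by rewrite gt_eqF.
  rewrite [leRHS]mulrAC; apply: ler_wpM2r => //.
  by rewrite ?(mulr_ge0, expR_ge0, exprn_ge0, invr_ge0, ltW rho0).
rewrite !big_nat; apply: ler_sum => k /andP[Kk kK]; exact: term.
Qed.

(** Waiting for [M] time steps drops the first [M] terms of the sum. *)
Lemma green_shift h s M : 0 < h ->
  (\sum_(0 <= k <oo) (h * heat (h * k.+1%:R + h * M%:R) s)%:E <= green h s)%E.
Proof.
move=> h0; apply: lime_le.
  by apply: is_cvg_nneseries => k _ _; rewrite lee_fin mulr_ge0 ?heat_ge0 ?ltW.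
apply: nearW => n.
apply: (@le_trans _ _ (\sum_(0 <= k < n + M) (h * heat (h * k.+1%:R) s)%:E)%E); last first.
  by apply: nneseries_lim_ge => k _ _; exact: green_term_ge0.
rewrite [leRHS](@big_cat_nat _ _ _ M)/=; [|by []|by rewrite leq_addl].
apply: (@le_trans _ _ (\sum_(M <= k < n + M) (h * heat (h * k.+1%:R) s)%:E)%E); last first.
  by rewrite leeDr// sume_ge0// => k _; exact: green_term_ge0.
rewrite -[in leRHS](add0n M) big_addn add0n addnK; apply: lee_sum => k _.
by rewrite -mulrDr -natrD addSn.
Qed.

End heat_kernel.

(** * Comparison principle for a killed random walk *)

Section kernel.
Local Open Scope ereal_scope.
Context (R : realType) (d : nat) (disp : measure_display)
  (T : measurableType disp) (P : probability T R).
Local Notation V := (g_sigma_algebraType (@box_system R d)).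
Variable N : T -> 'rV[R]_d.
Hypothesis mN : measurable_fun setT (N : T -> V).
Implicit Types f g : V -> \bar R.

(** Transition operator of the random walk with increments distributed as [N]. *)
Definition step f (z : V) : \bar R := \int[P]_w f ((z : 'rV[R]_d) + N w)%R.

(** Transition operator of the walk killed outside [D]. *)
Definition killed (D : set V) f (z : V) : \bar R := (\1_D z)%:E * step f z.

Lemma measurable_shift f z : measurable_fun setT f ->
  measurable_fun setT (fun w => f ((z : 'rV[R]_d) + N w)%R).
Proof.
move=> mf; apply: (measurableT_comp mf).
exact: (@measurable_vecD _ _ _ _ (fun=> z : V) N).
Qed.

Lemma measurable_step f : measurable_fun setT f -> (forall z, 0 <= f z) ->
  measurable_fun setT (step f).
Proof.
move=> mf f0.
apply: (@measurable_fun_fubini_tonelli_F _ _ V T R P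
  (fun p : V * T => f ((p.1 : 'rV[R]_d) + N p.2)%R)) => //.
apply: (measurableT_comp mf); apply: measurable_vecD.
  exact: measurable_fst.
by apply: (measurableT_comp mN); exact: measurable_snd.
Qed.

Lemma step_ge0 f z : (forall z, 0 <= f z) -> 0 <= step f z.
Proof. by move=> f0; apply: integral_ge0. Qed.

Lemma le_step f g z : measurable_fun setT f -> measurable_fun setT g ->
  (forall z, 0 <= f z) -> (forall z, f z <= g z) -> step f z <= step g z.
Proof.
move=> mf mg f0 fg; apply: ge0_le_integral => //; exact: measurable_shift.
Qed.

Lemma stepD f g z : measurable_fun setT f -> measurable_fun setT g ->
  (forall z, 0 <= f z) -> (forall z, 0 <= g z) ->
  step (fun z => f z + g z) z = step f z + step g z.
Proof.
move=> mf mg f0 g0; rewrite /step ge0_integralD//; exact: measurable_shift.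
Qed.

Lemma step_scale (c : R) f z : measurable_fun setT f -> (forall z, 0 <= f z) ->
  (0 <= c)%R -> step (fun z => c%:E * f z) z = c%:E * step f z.
Proof.
move=> mf f0 c0; rewrite /step ge0_integralZl_EFin//; exact: measurable_shift.
Qed.

Lemma step_le1 f z : measurable_fun setT f -> (forall z, 0 <= f z) ->
  (forall z, f z <= 1) -> step f z <= 1.
Proof.
move=> mf f0 f1; apply: (@le_trans _ _ (\int[P]_w (cst 1 w))).
  apply: ge0_le_integral => //; exact: measurable_shift.
by rewrite integral_cst// mul1e; exact: probability_le1.
Qed.

Lemma killed_ge0 D f z : (forall z, 0 <= f z) -> 0 <= killed D f z.
Proof. by move=> f0; rewrite mule_ge0 ?step_ge0. Qed.

Lemma measurable_killed (D : set V) f : measurable D ->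
  measurable_fun setT f -> (forall z, 0 <= f z) ->
  measurable_fun setT (killed D f).
Proof.
move=> mD mf f0; apply: emeasurable_funM; last exact: measurable_step.
by apply/measurable_EFinP; exact: measurable_indic.
Qed.

Lemma killed_in (D : set V) f z : D z -> killed D f z = step f z.
Proof. by move=> Dz; rewrite /killed indicE mem_set// mul1e. Qed.

Lemma iter_killed (D : set V) f k : measurable D ->
  measurable_fun setT f -> (forall z, 0 <= f z) ->
  measurable_fun setT (iter k (killed D) f) /\
  (forall z, 0 <= iter k (killed D) f z).
Proof.
move=> mD mf f0; elim: k => [//|k [mk k0]] /=.
by split; [exact: measurable_killed|move=> z; exact: killed_ge0].
Qed.

Lemma iter_step f k : measurable_fun setT f -> (forall z, 0 <= f z) ->
  [/\ measurable_fun setT (iter k step f), (forall z, 0 <= iter k step f z) &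
      (forall z, f z <= 1) -> forall z, iter k step f z <= 1].
Proof.
move=> mf f0; elim: k => [//|k [mk k0 k1]] /=; split.
- exact: measurable_step.
- by move=> z; exact: step_ge0.
- by move=> f1 z; apply: step_le1 => //; exact: k1.
Qed.

Lemma le_iter_killed (D : set V) f g k z : measurable D ->
  measurable_fun setT f -> measurable_fun setT g ->
  (forall z, 0 <= f z) -> (forall z, f z <= g z) ->
  iter k (killed D) f z <= iter k (killed D) g z.
Proof.
move=> mD mf mg f0 fg.
have g0 z' : 0 <= g z' by apply: le_trans (fg z').
elim: k z => [//|k IH] z /=.
have [mk k0] := iter_killed k mD mf f0; have [mk' k0'] := iter_killed k mD mg g0.
rewrite /killed lee_wpmul2l//; exact: le_step.
Qed.

Lemma iter_killed_scale (D : set V) (c : R) f k z : measurable D ->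
  measurable_fun setT f -> (forall z, 0 <= f z) -> (0 <= c)%R ->
  iter k (killed D) (fun z => c%:E * f z) z = c%:E * iter k (killed D) f z.
Proof.
move=> mD mf f0 c0; elim: k z => [//|k IH] z /=.
have [mk k0] := iter_killed k mD mf f0.
rewrite /killed (_ : iter k _ _ = fun z => c%:E * iter k (killed D) f z).
  by rewrite step_scale// muleCA.
exact/funext.
Qed.

(** The maximum principle behind every estimate. If [W k] is superharmonic
    in space and time, [k] being the number of steps left, and is at least 1
    outside [D], then killing the walk outside [D] costs at most [W]: outside
    [D] the bound is trivial, and inside it follows by applying [step] to the
    previous bound. No stopping time is involved. *)
Lemma comparison (D : set V) f g (W : nat -> V -> \bar R) K : measurable D ->
  measurable_fun setT f -> measurable_fun setT g ->
  (forall z, 0 <= f z) -> (forall z, f z <= 1) -> (forall z, 0 <= g z) ->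
  (forall k, (k <= K)%N -> measurable_fun setT (W k)) ->
  (forall k z, (k <= K)%N -> 0 <= W k z) ->
  (forall k z, (k < K)%N -> step (W k) z <= W k.+1 z) ->
  (forall k z, (k <= K)%N -> ~ D z -> 1 <= W k z) ->
  (forall z, f z <= g z + W 0%N z) ->
  forall k z, (k <= K)%N ->
    iter k step f z <= iter k (killed D) g z + W k z.
Proof.
move=> mD mf mg f0 f1 g0 mW W0 Wstep W1 fgW.
elim=> [|k IH] z kK; first exact: fgW.
have [mk k0 _] := iter_step k mf f0.
have [mk' k0'] := iter_killed k mD mg g0.
have [mk1 k1 /(_ f1) le1] := iter_step k.+1 mf f0.
have [Dz|nDz] := pselect (D z); last first.
  apply: (@le_trans _ _ 1); first exact: le1.
  apply: (@le_trans _ _ (W k.+1 z)); first exact: W1.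
  by rewrite leeDr// killed_ge0.
rewrite /= killed_in//.
apply: (@le_trans _ _ (step (fun z => iter k (killed D) g z + W k z) z)).
  apply: le_step => //; last by move=> z'; apply: IH; exact: ltnW.
  by apply: emeasurable_funD => //; apply: mW; exact: ltnW.
rewrite stepD//; first by rewrite leeD2l// Wstep.
- by apply: mW; exact: ltnW.
- by move=> z'; apply: W0; exact: ltnW.
Qed.

End kernel.

(** * Markov property of Brownian motion on a time grid *)

Section brownian_grid.
Local Open Scope ereal_scope.
Context (R : realType) (d : nat) (disp : measure_display)
  (T : measurableType disp) (P : probability T R) (B : R -> T -> 'rV[R]_d).
Hypothesis bmB : brownian_motion P B.
Local Notation V := (g_sigma_algebraType (@box_system R d)).

Lemma measurable_bm t : (0 <= t)%R -> measurable_fun setT (B t : T -> V).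
Proof.
move=> t0; apply: random_vector_measurable.
exact: (@bm_random_vector _ _ _ _ _ _ bmB t t0).
Qed.

Lemma bm_gaussian t : (0 < t)%R -> centered_gaussian P (Num.sqrt t) (B t).
Proof.
move=> t0; have := bm_gaussian_increments bmB (lexx 0%R) t0.
rewrite subr0 (_ : (fun w => _) = B t)//.
by apply/funext => w; rewrite (bm_start bmB) subr0.
Qed.

Variable h : R.
Hypothesis h0 : (0 < h)%R.

Lemma grid_ge0 i : (0 <= h * i%:R)%R.
Proof. by rewrite mulr_ge0 ?(ltW h0). Qed.

Definition increment (k : nat) (i : 'I_k) (w : T) : 'rV[R]_d :=
  (B (h * i.+1%:R) w - B (h * i%:R) w)%R.

Lemma measurable_increment k i : measurable_fun setT (@increment k i : T -> V).
Proof.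
apply: measurable_to_vec => j; rewrite /increment.
under eq_fun do rewrite !mxE.
by apply: measurable_funB; apply: measurable_vec_coord; apply: measurable_bm; exact: grid_ge0.
Qed.

Lemma increment_independent k :
  mutually_independent P (fun i => @increment k i : T -> V).
Proof.
move=> A mA; apply: (bm_independent_increments bmB (t := fun i => (h * i%:R)%R)).
- exact: grid_ge0.
- by move=> i j ij; rewrite ler_wpM2l ?(ltW h0)// ler_nat.
- by move=> i; exact: box_system_borel.
Qed.

Lemma increment_gaussian k i : centered_gaussian P (Num.sqrt h) (@increment k i).
Proof.
have lt : (h * i%:R < h * i.+1%:R)%R by rewrite ltr_pM2l// ltr_nat.
have := bm_gaussian_increments bmB (grid_ge0 i) lt.
have -> : (h * i.+1%:R - h * i%:R = h)%R by rewrite -natr1 mulrDr mulr1 addrC addKr.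
by [].
Qed.

Definition stays (D : set V) (y : V) (k : nat) : set T :=
  [set w | forall i, (i <= k)%N -> D ((y : 'rV[R]_d) + B (h * i%:R) w)%R].

Lemma measurable_stays D y k : measurable D -> measurable (stays D y k).
Proof.
move=> mD; rewrite (_ : stays D y k =
  \bigcap_(i in `I_k.+1) ((fun w => ((y : 'rV[R]_d) + B (h * i%:R) w)%R : V) @^-1` D)).
  apply: fin_bigcap_measurable => // i _; rewrite -[X in measurable X]setTI.
  apply: (@measurable_vecD _ _ _ _ (fun=> y : V) (B (h * i%:R))) => //.
  by apply: measurable_bm; exact: grid_ge0.
by apply/seteqP; split=> w /= + i; apply.
Qed.

Local Notation past_type k :=
  (g_sigma_algebraType (past (fun i => @increment k.+1 i : T -> V) k)).

Lemma measurable_bm_past k i : (i <= k)%N ->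
  measurable_fun setT (B (h * i%:R) : past_type k -> V).
Proof.
elim: i => [_|i IH ik].
  rewrite mulr0 (_ : B 0 = fun=> 0%R); first exact: measurable_cst.
  by apply/funext => w; rewrite (bm_start bmB).
have ik1 : (i < k.+1)%N by exact: ltnW.
have -> : B (h * i.+1%:R) = (fun w => (B (h * i%:R) w + increment (Ordinal ik1) w)%R).
  by apply/funext => w; rewrite /increment /= addrC subrK.
apply: measurable_vecD; first by apply: IH; exact: ltnW.
exact: (@measurable_past_comp _ _ _ _ _ (fun i => @increment k.+1 i : T -> V) k).
Qed.

Lemma measurable_stays_past D y k : measurable D ->
  measurable (stays D y k : set (past_type k)).
Proof.
move=> mD; rewrite (_ : stays D y k =
  \bigcap_(i in `I_k.+1) ((fun w => ((y : 'rV[R]_d) + B (h * i%:R) w)%R : V) @^-1` D)).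
  apply: fin_bigcap_measurable => // i ik; rewrite -[X in measurable X]setTI.
  apply: (@measurable_vecD _ _ _ (past_type k) (fun=> y : V) (B (h * i%:R))) => //.
  exact: measurable_bm_past.
by apply/seteqP; split=> w /= + i; apply.
Qed.

Lemma staysS D y k w : \1_(stays D y k.+1) w =
  (\1_(stays D y k) w * \1_D (((y : 'rV[R]_d) + B (h * k.+1%:R) w)%R : V))%R :> R.
Proof.
rewrite !indicE -natrM mulnb; congr (nat_of_bool _)%:R.
apply/idP/andP; rewrite !inE.
  by move=> S; split=> [i ik|]; apply: S => //; exact: leqW.
move=> [S DS] i; rewrite leq_eqVlt => /orP[/eqP ->//|]; exact: S.
Qed.

(** By induction on [k]: the last increment is independent of the past and has
    the law of [B h], so integrating it out replaces [f] by its image under one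
    transition. *)
Lemma grid_markov (D : set V) (y : V) k (f : V -> \bar R) : measurable D ->
  measurable_fun setT f -> (forall z, 0 <= f z) ->
  \int[P]_w ((\1_(stays D y k) w)%:E * f ((y : 'rV[R]_d) + B (h * k%:R) w)%R) =
  iter k (killed P (B h) D) (fun z => (\1_D z)%:E * f z) y.
Proof.
move=> mD; elim: k f => [|k IH] f mf f0.
  under eq_integral => w _.
    rewrite mulr0 (bm_start bmB) addr0.
    rewrite (_ : \1_(stays D y 0) w = \1_D y :> R); last first.
      rewrite !indicE; congr (nat_of_bool _)%:R; apply/idP/idP; rewrite !inE.
        by move=> /(_ 0%N (leqnn _)); rewrite mulr0 (bm_start bmB) addr0.
      by move=> Dy i; rewrite leqn0 => /eqP ->; rewrite mulr0 (bm_start bmB) addr0.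
    over.
  by rewrite integral_cst//= probability_setT mule1.
pose g z := (\1_D z)%:E * f z.
have mg : measurable_fun setT (g : V -> \bar R).
  by apply: emeasurable_funM => //; apply/measurable_EFinP; exact: measurable_indic.
have g0 z : 0 <= g z by rewrite mule_ge0.
pose F (p : past_type k * V) :=
  (\1_(stays D y k) p.1)%:E * g ((y : 'rV[R]_d) + B (h * k%:R) p.1 + p.2)%R.
have mBh : measurable_fun setT (B h : T -> V) by apply: measurable_bm; exact: ltW.
have mF : measurable_fun setT F.
  apply: emeasurable_funM.
    apply/measurable_EFinP; apply: measurableT_comp (@measurable_fst _ _ _ _).
    by apply: measurable_indic; exact: measurable_stays_past.
  apply: (measurableT_comp mg); apply: measurable_vecD; last exact: measurable_snd.
  apply: (@measurable_vecD _ _ _ (past_type k * V)%type (fun=> y : V)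
    (fun p : past_type k * V => B (h * k%:R) p.1)) => //.
  exact: (measurableT_comp (measurable_bm_past (leqnn k)) (@measurable_fst _ _ _ _)).
have F0 p : 0 <= F p by rewrite mule_ge0.
transitivity (\int[P]_w F (w, @increment k.+1 ord_max w)).
  apply: eq_integral => w _; rewrite staysS EFinM -muleA /F /=; congr (_ * _).
  by rewrite /increment /g /= -addrA [(B (h * k%:R) w + _)%R]addrC subrK.
rewrite (@ge0_integral_past_next _ _ _ _ _ _ _ (fun i => @increment k.+1 i : T -> V)
  (@measurable_increment k.+1) (@increment_independent k.+1) ord_max F)//.
transitivity (\int[P]_w ((\1_(stays D y k) w)%:E *
    step P (B h) g ((y : 'rV[R]_d) + B (h * k%:R) w)%R)).
  apply: eq_integral => w _; rewrite /F /=.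
  rewrite ge0_integralZl_EFin//; last first.
    apply: (@measurable_shift _ _ _ _ _ (measurable_increment ord_max)) => //.
  congr (_ * _).
  apply: (@gaussian_law _ _ _ _ P _ (B h) _
    (fun x : V => g ((y : 'rV[R]_d) + B (h * k%:R) w + x)%R)
    (measurable_increment _) mBh (increment_gaussian _) (bm_gaussian h0)) => //.
  apply: (measurableT_comp mg).
  exact: (@measurable_vecD _ _ _ V (fun=> _ : V) (fun x : V => x)).
rewrite (IH (step P (B h) g)); [|exact: measurable_step|by move=> z; exact: step_ge0].
by rewrite iterSr.
Qed.

End brownian_grid.

(** * Superharmonic functions for the grid walk *)

Section potentials.
Local Open Scope ring_scope.
Context (R : realType) (d : nat).
Local Notation V := (g_sigma_algebraType (@box_system R d)).
Implicit Types (c z : 'rV[R]_d) (r h : R).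

Lemma sqnorm_ge0 z : 0 <= sqnorm z.
Proof. by apply: sumr_ge0 => j _; exact: sqr_ge0. Qed.

Lemma enorm_sqnorm z : enorm z = Num.sqrt (sqnorm z).
Proof. by []. Qed.

Lemma sqr_enorm z : enorm z ^+ 2 = sqnorm z.
Proof. by rewrite sqr_sqrtr// sqnorm_ge0. Qed.

Lemma measurable_sqnorm c : measurable_fun setT (fun z : V => sqnorm ((z : 'rV[R]_d) - c)).
Proof.
apply: measurable_sum => j; apply: measurable_funX.
under eq_fun do rewrite !mxE.
by apply: measurable_funB => //; exact: measurable_coord.
Qed.

Lemma measurable_enorm c : measurable_fun setT (fun z : V => enorm ((z : 'rV[R]_d) - c)).
Proof.
have msqrt : measurable_fun setT (@Num.sqrt R).
  by apply: continuous_measurable_fun; exact: sqrt_continuous.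
exact: (measurableT_comp msqrt (@measurable_sqnorm c)).
Qed.

Lemma measurable_heat u : measurable_fun setT (heat d u : R -> R).
Proof.
apply: measurable_funM => //; apply: measurableT_comp => //.
by apply: measurable_funM => //; exact: measurableT_comp.
Qed.

Lemma measurable_antiheat u : measurable_fun setT (antiheat d u : R -> R).
Proof.
apply: measurable_funM => //; apply: measurableT_comp => //.
by apply: measurable_funM.
Qed.

Definition pot_const : R := 2 ^+ d / expR (- 2).

Lemma pot_const_gt0 : 0 < pot_const.
Proof. by rewrite divr_gt0 ?exprn_gt0 ?expR_gt0. Qed.

(** Multiple of the Green function centred at [c], normalised so as to be at
    least 1 on the ball of radius [2 * r]; there is room to spare because the
    closed balls will be enlarged. *)
Definition pot c r h (z : V) : \bar R :=
  ((pot_const * r ^+ (d - 2))%:E * green d h (sqnorm ((z : 'rV[R]_d) - c)))%E.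

Lemma measurable_pot c r h : 0 < h -> measurable_fun setT (pot c r h).
Proof.
move=> h0; apply: emeasurable_funM => //; apply: ge0_emeasurable_sum.
  by move=> k z _ _; exact: green_term_ge0.
move=> k _; apply/measurable_EFinP; apply: measurable_funM => //.
exact: (measurableT_comp (@measurable_heat _) (@measurable_sqnorm c)).
Qed.

Lemma pot_ge0 c r h z : 0 <= r -> 0 < h -> (0 <= pot c r h z)%E.
Proof.
move=> r0 h0; rewrite mule_ge0 ?green_ge0// lee_fin.
by rewrite mulr_ge0 ?exprn_ge0// ltW// pot_const_gt0.
Qed.

(** With [rho = r] this gives the lower bound 1 near the ball; with [rho] the
    distance from [z] to [c] it says that [pot] dominates the term of the series
    attached to the ball. *)
Lemma pot_ge c r h z rho : (2 <= d)%N -> 0 <= r -> 0 < h -> 0 < rho ->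
  h <= rho ^+ 2 -> enorm (z - c) <= 2 * rho ->
  (((r / rho) ^+ (d - 2))%:E <= pot c r h z)%E.
Proof.
move=> d2 r0 h0 rho0 hrho zc.
have sz : sqnorm (z - c) <= (2 * rho) ^+ 2.
  rewrite -sqr_enorm lerXn2r ?nnegrE ?sqrtr_ge0//.
  by rewrite mulr_ge0// ltW.
have P0 : 0 <= pot_const * r ^+ (d - 2).
  by rewrite mulr_ge0 ?exprn_ge0// ltW// pot_const_gt0.
apply: le_trans (lee_wpmul2l _ (green_ge d2 h0 rho0 hrho (sqnorm_ge0 _) sz)); last first.
  by rewrite lee_fin.
rewrite -EFinM lee_fin /pot_const le_eqVlt; apply/orP; left; apply/eqP.
rewrite expr_div_n -(exprVn rho); move: (rho^-1 ^+ _) (r ^+ _) => x y.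
have e0 : expR (- 2) != 0 :> R by rewrite gt_eqF ?expR_gt0.
have p0 : 2 ^+ d != 0 :> R by rewrite expf_neq0.
by move: (expR _) (2 ^+ d) e0 p0 => a b a0 b0; field; rewrite a0 b0.
Qed.

Lemma pot_ge1 c r h z : (2 <= d)%N -> 0 < h -> 0 < r -> h <= r ^+ 2 ->
  enorm (z - c) <= 2 * r -> (1 <= pot c r h z)%E.
Proof.
move=> d2 h0 r0 hr zc.
have := pot_ge d2 (ltW r0) h0 r0 hr zc.
by rewrite divff ?gt_eqF// expr1n.
Qed.

Definition hit_const : R := pot_const * (2 * heat_const R d).

Lemma hit_const_gt0 : (0 < d)%N -> 0 < hit_const.
Proof. by move=> d0; rewrite mulr_gt0 ?pot_const_gt0// mulr_gt0// heat_const_gt0. Qed.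

Lemma pot_le c r h z : (3 <= d)%N -> 0 <= r -> 0 < h -> 0 < enorm (z - c) ->
  (pot c r h z <= (hit_const * (r / enorm (z - c)) ^+ (d - 2))%:E)%E.
Proof.
move=> d3 r0 h0 zc.
have sz : 0 < sqnorm (z - c) by rewrite -sqr_enorm exprn_gt0.
have P0 : 0 <= pot_const * r ^+ (d - 2).
  by rewrite mulr_ge0 ?exprn_ge0// ltW// pot_const_gt0.
apply: le_trans (lee_wpmul2l _ (green_le d3 h0 sz)) _; first by rewrite lee_fin.
rewrite -EFinM lee_fin -enorm_sqnorm /hit_const le_eqVlt; apply/orP; left; apply/eqP.
rewrite expr_div_n -(exprVn (enorm _)).
move: (_^-1 ^+ _) (r ^+ _) (heat_const _ _) pot_const => x y a b.
ring.
Qed.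

End potentials.

Section potential_step.
Local Open Scope ring_scope.
Context (R : realType) (d : nat) (disp : measure_display)
  (T : measurableType disp) (P : probability T R) (B : R -> T -> 'rV[R]_d).
Hypothesis bmB : brownian_motion P B.
Local Notation V := (g_sigma_algebraType (@box_system R d)).

(** Chapman-Kolmogorov identity for the heat kernel. *)
Lemma heat_step t u z : 0 < t -> 0 < u ->
  (\int[P]_w (heat d u (sqnorm (z + B t w)))%:E = (heat d (u + t) (sqnorm z))%:E)%E.
Proof.
move=> t0 u0.
have mB := measurable_bm bmB (ltW t0).
have ut0 : 0 < u + t by rewrite addr_gt0.
under eq_integral do rewrite EFinM.
rewrite ge0_integralZl_EFin ?exprn_ge0 ?invr_ge0 ?sqrtr_ge0//; last first.
  apply/measurable_EFinP; apply: measurableT_comp => //; apply: measurable_funM => //.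
  apply: measurableT_comp => //.
  have := measurableT_comp (@measurable_sqnorm R d (- z)) mB.
  by apply: eq_measurable_fun => w _ /=; rewrite opprK addrC.
rewrite (gaussian_shift z mB (bm_gaussian bmB t0))// ?gt_eqF ?divr_gt0//.
rewrite -EFinM mulrA -exprMn /heat; congr ((_ ^+ _ * _)%:E).
rewrite -invfM -sqrtrM ?(ltW u0)//; congr (Num.sqrt _)^-1.
by rewrite mulrC divfK// gt_eqF.
Qed.

(** Chapman-Kolmogorov identity at a negative time. *)
Lemma antiheat_step t u z : 0 < t -> t < u ->
  (\int[P]_w (antiheat d u (sqnorm (z + B t w)))%:E =
   (antiheat d (u - t) (sqnorm z))%:E)%E.
Proof.
move=> t0 tu.
have u0 : 0 < u by apply: lt_trans tu.
have mB := measurable_bm bmB (ltW t0).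
have ut0 : 0 < u - t by rewrite subr_gt0.
have expE v s : expR (s / (2 * v)) = expR (- s / (2 * - v)) :> R.
  by rewrite mulrN invrN mulrNN.
under eq_integral do rewrite EFinM expE.
have eqE : (- u + t) / (- u) = (u - t) / u by rewrite invrN mulrN -mulNr opprD opprK.
rewrite ge0_integralZl_EFin ?exprn_ge0 ?invr_ge0 ?sqrtr_ge0//; last first.
  apply/measurable_EFinP; apply: measurableT_comp => //; apply: measurable_funM => //.
  apply: measurableT_comp => //.
  have := measurableT_comp (@measurable_sqnorm R d (- z)) mB.
  by apply: eq_measurable_fun => w _ /=; rewrite opprK addrC.
rewrite (gaussian_shift z mB (bm_gaussian bmB t0))// ?oppr_eq0 ?gt_eqF ?eqE ?divr_gt0//.
rewrite -EFinM mulrA -exprMn /antiheat [in RHS]expE opprB [- u + t]addrC.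
congr ((_ ^+ _ * _)%:E).
rewrite -invfM -sqrtrM ?(ltW u0)//; congr (Num.sqrt _)^-1.
by rewrite mulrC divfK// gt_eqF.
Qed.

(** Termwise, a step of length [h * M] shifts the heat kernel by [M] grid
    times. *)
Lemma green_step h M z : 0 < h -> (0 < M)%N ->
  (\int[P]_w green d h (sqnorm (z + B (h * M%:R) w)) <= green d h (sqnorm z))%E.
Proof.
move=> h0 M0.
have t0 : 0 < h * M%:R by rewrite mulr_gt0 ?ltr0n.
have mB := measurable_bm bmB (ltW t0).
have mterm k : measurable_fun setT
    (fun w => heat d (h * k.+1%:R) (sqnorm (z + B (h * M%:R) w))).
  apply: (measurableT_comp (@measurable_heat R d _)).
  have := measurableT_comp (@measurable_sqnorm R d (- z)) mB.
  by apply: eq_measurable_fun => w _ /=; rewrite opprK addrC.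
rewrite /green integral_nneseries//; last 2 first.
- by move=> k; apply/measurable_EFinP; exact: measurable_funM.
- by move=> k w _; exact: green_term_ge0.
apply: le_trans (green_shift d (sqnorm z) M h0).
apply: lee_nneseries => [k _ _|k _].
  apply: integral_ge0 => w _; exact: green_term_ge0.
under eq_integral do rewrite EFinM.
rewrite ge0_integralZl_EFin ?(ltW h0)//; last 2 first.
- by move=> w _; rewrite lee_fin heat_ge0.
- exact/measurable_EFinP.
by rewrite heat_step ?EFinM// mulr_gt0 ?ltr0n.
Qed.

Lemma pot_step c r h M z : 0 <= r -> 0 < h -> (0 < M)%N ->
  (step P (B (h * M%:R)) (pot c r h) z <= pot c r h z)%E.
Proof.
move=> r0 h0 M0.
have t0 : 0 < h * M%:R by rewrite mulr_gt0 ?ltr0n.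
have mB := measurable_bm bmB (ltW t0).
have P0 : 0 <= pot_const R d * r ^+ (d - 2).
  by rewrite mulr_ge0 ?exprn_ge0// ltW// pot_const_gt0.
rewrite /step /pot ge0_integralZl_EFin//; last 2 first.
- by move=> w _; exact: green_ge0.
- apply: ge0_emeasurable_sum => [k w _ _|k _]; first exact: green_term_ge0.
  apply/measurable_EFinP; apply: measurable_funM => //.
  apply: (measurableT_comp (@measurable_heat R d _)).
  have := measurableT_comp (@measurable_sqnorm R d (c - z)) mB.
  by apply: eq_measurable_fun => w _ /=; rewrite opprB addrCA addrA.
rewrite lee_wpmul2l ?lee_fin//.
under eq_integral do rewrite addrAC.
exact: green_step.
Qed.

End potential_step.

(** * Hitting probabilities of balls *)

Section hitting.
Local Open Scope ring_scope.
Context (R : realType) (d : nat) (disp : measure_display)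
  (T : measurableType disp) (P : probability T R) (B : R -> T -> 'rV[R]_d).
Hypothesis bmB : brownian_motion P B.
Hypothesis d3 : (3 <= d)%N.
Local Notation V := (g_sigma_algebraType (@box_system R d)).

Let d2 : (2 <= d)%N. Proof. exact: ltnW. Qed.
Let d0 : (0 < d)%N. Proof. exact: ltn_trans d3. Qed.

Definition mesh_div (t r : R) : nat := (Num.truncn (t / r ^+ 2)).+1.
(** The Green function is comparable to the Newtonian kernel only beyond
    distance [sqrt h], so a small ball needs a fine mesh. Each ball gets its own
    mesh, an integer fraction of the common time step [t] so that [pot] remains
    superharmonic for steps of length [t]. *)
Definition mesh (t r : R) : R := t / (mesh_div t r)%:R.

Lemma mesh_gt0 t r : 0 < t -> 0 < mesh t r.
Proof. by move=> t0; rewrite divr_gt0 ?ltr0n. Qed.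

Lemma mesh_le t r : 0 < t -> 0 < r -> mesh t r <= r ^+ 2.
Proof.
move=> t0 r0; rewrite /mesh ler_pdivrMr ?ltr0n// mulrC -ler_pdivrMr ?exprn_gt0//.
have q0 : 0 <= t / r ^+ 2 by rewrite divr_ge0 ?sqr_ge0 ?(ltW t0).
by have /andP[_ /ltW] := truncn_itv q0.
Qed.

Lemma meshK t r : mesh t r * (mesh_div t r)%:R = t.
Proof. by rewrite /mesh divfK// pnatr_eq0. Qed.

Definition total_pot (c : nat -> 'rV[R]_d) (r : nat -> R) (t : R) (z : V) : \bar R :=
  (\sum_(0 <= n <oo) pot (c n) (r n) (mesh t (r n)) z)%E.

(** The series of the statement, seen from the point [z]. *)
Definition riesz_sum (c : nat -> 'rV[R]_d) (r : nat -> R) (z : 'rV[R]_d) : \bar R :=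
  (\sum_(0 <= n <oo) ((r n / enorm (z - c n)) ^+ (d - 2))%:E)%E.

Variables (c : nat -> 'rV[R]_d) (r : nat -> R) (t : R).
Hypotheses (r0 : forall n, 0 < r n) (t0 : 0 < t).

Lemma total_pot_term_ge0 n z : (0 <= pot (c n) (r n) (mesh t (r n)) z)%E.
Proof. by apply: pot_ge0; [exact: ltW|exact: mesh_gt0]. Qed.

Lemma total_pot_ge0 z : (0 <= total_pot c r t z)%E.
Proof. by apply: nneseries_ge0 => n _ _; exact: total_pot_term_ge0. Qed.

Lemma measurable_total_pot : measurable_fun setT (total_pot c r t).
Proof.
apply: ge0_emeasurable_sum => [n z _ _|n _]; first exact: total_pot_term_ge0.
by apply: measurable_pot; exact: mesh_gt0.
Qed.

Lemma total_pot_ge n z :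
  (pot (c n) (r n) (mesh t (r n)) z <= total_pot c r t z)%E.
Proof.
apply: (@le_trans _ _ (\sum_(0 <= k < n.+1) pot (c k) (r k) (mesh t (r k)) z)%E).
  rewrite big_nat_recr//= leeDr// sume_ge0// => k _; exact: total_pot_term_ge0.
by apply: nneseries_lim_ge => k _ _; exact: total_pot_term_ge0.
Qed.

Lemma total_pot_ge1 n z : enorm (z - c n) <= 2 * r n -> (1 <= total_pot c r t z)%E.
Proof.
move=> zc; apply: le_trans (total_pot_ge n z).
by apply: pot_ge1 => //; [exact: mesh_gt0|exact: mesh_le].
Qed.

Lemma total_pot_le z : (forall n, 0 < enorm (z - c n)) ->
  (total_pot c r t z <= (hit_const R d)%:E * riesz_sum c r z)%E.
Proof.
move=> zc; rewrite /riesz_sum -nneseriesZl; last first.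
  by move=> n _; rewrite lee_fin exprn_ge0// divr_ge0// ltW.
apply: lee_nneseries => n _; first by move=> _; exact: total_pot_term_ge0.
by rewrite -EFinM; apply: pot_le => //; [exact: ltW|exact: mesh_gt0].
Qed.

Lemma total_pot_step z : (step P (B t) (total_pot c r t) z <= total_pot c r t z)%E.
Proof.
have mB := measurable_bm bmB (ltW t0).
rewrite /step /total_pot integral_nneseries//; last 2 first.
- by move=> n; apply: (measurable_shift mB); apply: measurable_pot; exact: mesh_gt0.
- by move=> n w _; exact: total_pot_term_ge0.
apply: lee_nneseries => n _.
  by move=> _; apply: integral_ge0 => w _; exact: total_pot_term_ge0.
have := pot_step bmB (c n) (M := mesh_div t (r n)) z (ltW (r0 n))
  (mesh_gt0 (r n) t0) isT.
by rewrite meshK.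
Qed.

(** [alive h D k z] is the probability that the walk of mesh [h] started at [z]
    stays in [D] during [k] steps. *)
Definition alive (h : R) (D : set V) (k : nat) : V -> \bar R :=
  iter k (killed P (B h) D) (fun z => (\1_D z)%:E).

(** Comparison with the total potential, which does not depend on the number
    of steps and which [total_pot_le] bounds uniformly in the time step. *)
Lemma hitting_bound (D : set V) k z : measurable D ->
  (forall z, ~ D z -> exists n, enorm (z - c n) <= 2 * r n) ->
  (1 <= alive t D k z + total_pot c r t z)%E.
Proof.
move=> mD Dc.
have mB := measurable_bm bmB (ltW t0).
have step1 j : iter j (step P (B t)) (fun=> 1%E) = fun=> 1%E.
  elim: j => [//|j IH] /=; rewrite IH; apply/funext => y; rewrite /step.
  by rewrite integral_cst//= mul1e; exact: probability_setT.
have out z' : ~ D z' -> (1 <= total_pot c r t z')%E.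
  by move=> /Dc[n]; exact: total_pot_ge1.
have := @comparison _ _ _ _ P (B t) mB D (fun=> 1%E) (fun z => (\1_D z)%:E)
  (fun=> total_pot c r t) k mD.
move=> /(_ _ _ _ _ _ _ _ _ _ _ k z (leqnn k)); rewrite step1; apply => //.
- by apply/measurable_EFinP; exact: measurable_indic.
- by move=> _ _; exact: measurable_total_pot.
- by move=> _ z' _; exact: total_pot_ge0.
- by move=> _ z' _; exact: total_pot_step.
- by move=> _ z' _; exact: out.
- move=> z'; have [Dz|nDz] := pselect (D z'); last first.
    by apply: (le_trans (out _ nDz)); rewrite leeDr// lee_fin.
  by rewrite indicE mem_set// leeDl// total_pot_ge0.
Qed.

End hitting.

Section gaussian_box.
Local Open Scope ring_scope.
Context (R : realType) (d : nat) (disp : measure_display)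
  (T : measurableType disp) (P : probability T R) (N : T -> 'rV[R]_d).

(** The hypothesis on [t] says that the interval is not shorter than the
    inverse of the maximum of the density; the bound then loses nothing but the
    exponential factor. *)
Lemma normal_itv (t a delta m : R) : 0 < t -> 0 < delta ->
  `|a| + delta <= m -> t * pi *+ 2 <= (2 * delta) ^+ 2 ->
  ((expR (- m ^+ 2 / (2 * t)))%:E <=
    normal_prob 0 (Num.sqrt t) (`](a - delta)%R, (a + delta)%R[%classic : set R))%E.
Proof.
move=> t0 delta0 am tdelta.
have st0 : Num.sqrt t != 0 by rewrite gt_eqF ?sqrtr_gt0.
have tpi0 : 0 < t * pi *+ 2 by rewrite mulrn_wgt0// mulr_gt0// pi_gt0.
pose K : R := normal_peak (Num.sqrt t) * expR (- m ^+ 2 / (2 * t)).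
have K0 : 0 <= K by rewrite mulr_ge0 ?expR_ge0 ?normal_peak_ge0.
apply: (@le_trans _ _
  (\int[lebesgue_measure]_(x in `](a - delta)%R, (a + delta)%R[) (cst K%:E x))%E).
  rewrite integral_cst//= lebesgue_measure_itv/= lte_fin.
  rewrite (_ : a - delta < a + delta); last by lra.
  rewrite -EFinD -EFinM lee_fin /K mulrAC.
  rewrite ler_peMl ?expR_ge0// /normal_peak sqr_sqrtr ?(ltW t0)//.
  rewrite mulrC ler_pdivlMr ?sqrtr_gt0// mul1r.
  rewrite (_ : a + delta - (a - delta) = 2 * delta); last by ring.
  rewrite -[leRHS]ger0_norm ?mulr_ge0 ?(ltW delta0)// -sqrtr_sqr.
  by rewrite ler_sqrt ?sqr_ge0.
rewrite /normal_prob; apply: ge0_le_integral => //.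
- apply/measurable_EFinP; apply: measurable_funTS; exact: measurable_normal_pdf.
- move=> x /=; rewrite in_itv/= => /andP[xa xb]; rewrite lee_fin normal_pdfE//.
  rewrite ler_wpM2l ?normal_peak_ge0// /normal_fun ler_expR subr0 sqr_sqrtr ?(ltW t0)//.
  rewrite -(mulr_natl t 2) ler_pM2r ?invr_gt0 ?mulr_gt0// lerN2.
  rewrite -[leLHS]real_normK ?num_real// lerXn2r ?nnegrE//.
    by apply: le_trans am; rewrite addr_ge0// ltW.
  apply: le_trans am; rewrite ler_norml; have := ler_norm a; have := ler_norm (- a).
  by rewrite normrN; lra.
Qed.

Lemma gaussian_box (t delta m : R) (a : 'I_d -> R) :
  centered_gaussian P (Num.sqrt t) N ->
  0 < t -> 0 < delta -> (forall j, `|a j| + delta <= m) ->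
  t * pi *+ 2 <= (2 * delta) ^+ 2 ->
  ((expR (- m ^+ 2 / (2 * t)) ^+ d)%:E <=
    P [set w | forall j, (`|N w ord0 j - a j| < delta)%R])%E.
Proof.
move=> gN t0 delta0 am tdelta.
pose A j : set R := `]a j - delta, a j + delta[%classic.
rewrite (_ : [set w | _] = [set w | forall j, A j (N w ord0 j)]); last first.
  apply/seteqP; split=> w /= + j => /(_ j); rewrite /A /= in_itv/= ltr_norml; lra.
rewrite gN; last by move=> j; exact: measurable_itv.
have Afin j : normal_prob 0 (Num.sqrt t) (A j) \is a fin_num.
  by apply: fin_num_measure; exact: measurable_itv.
rewrite (eq_bigr (fun j => (fine (normal_prob 0 (Num.sqrt t) (A j)))%:E)); last first.
  by move=> j _; rewrite fineK.
rewrite prodEFin lee_fin -[X in _ ^+ X]card_ord -prodr_const.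
apply: ler_prod => j _; rewrite expR_ge0/= -lee_fin fineK//.
exact: normal_itv.
Qed.

End gaussian_box.

(** * Reaching a small box without leaving a large one *)

Section enorm_facts.
Local Open Scope ring_scope.
Context (R : realType) (d : nat).
Implicit Types z : 'rV[R]_d.

Lemma coord_le_enorm z j : `|z ord0 j| <= enorm z.
Proof.
rewrite -sqrtr_sqr ler_sqrt ?sqnorm_ge0// (bigD1 j)//= lerDl.
by apply: sumr_ge0 => i _; exact: sqr_ge0.
Qed.

Lemma enormZ (a : R) z : 0 <= a -> enorm (a *: z) = a * enorm z.
Proof.
move=> a0; rewrite /enorm -[X in _ = X * _]ger0_norm// -sqrtr_sqr -sqrtrM ?sqr_ge0//.
congr Num.sqrt; rewrite mulr_sumr; apply: eq_bigr => j _.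
by rewrite mxE exprMn.
Qed.

Lemma enorm_ge0 z : 0 <= enorm z.
Proof. exact: sqrtr_ge0. Qed.

End enorm_facts.

Section local_step.
Local Open Scope ring_scope.
Context (R : realType) (d : nat) (disp : measure_display)
  (T : measurableType disp) (P : probability T R) (B : R -> T -> 'rV[R]_d).
Hypothesis bmB : brownian_motion P B.
Local Notation V := (g_sigma_algebraType (@box_system R d)).

Definition box (x : 'rV[R]_d) (delta : R) : set 'rV[R]_d :=
  [set z | forall j, `|z ord0 j - x ord0 j| < delta].

Lemma measurable_box x delta : measurable (box x delta : set V).
Proof.
apply: sub_sigma_algebra.
exists (fun j => `](x ord0 j - delta), (x ord0 j + delta)[%classic).
  by move=> j; exact: measurable_itv.
by apply/seteqP; split=> z /= + j => /(_ j); rewrite in_itv/= ltr_norml; lra.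
Qed.

Lemma iter_step_grid h k (A : set V) y : 0 < h -> measurable A ->
  iter k (step P (B h)) (fun z => (\1_A z)%:E) y =
  P [set w | A ((y : 'rV[R]_d) + B (h * k%:R) w)%R].
Proof.
move=> h0 mA.
have killedT : killed P (B h) (setT : set V) = step P (B h).
  by apply/funext => f; apply/funext => z; rewrite killed_in.
have mf : measurable_fun setT (fun z : V => (\1_A z)%:E : \bar R).
  by apply/measurable_EFinP; exact: measurable_indic.
have f0 (z : V) : (0 <= (\1_A z)%:E :> \bar R)%E by rewrite lee_fin.
have := grid_markov bmB h0 y k (@measurableT _ V) mf f0.
rewrite killedT (_ : (fun z => _ * _)%E = fun z : V => (\1_A z)%:E); last first.
  by apply/funext => z; rewrite indicT mul1e.
move=> <-; have mS : measurable [set w | A ((y : 'rV[R]_d) + B (h * k%:R) w)%R].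
  rewrite -[X in measurable X]setTI.
  have mBk : measurable_fun setT (B (h * k%:R) : T -> V).
    by apply: (measurable_bm bmB); exact: grid_ge0.
  exact: (@measurable_vecD R d _ T (fun=> y : V) (B (h * k%:R))).
rewrite -[X in P X]setIT -integral_indic//; apply: eq_integral => w _.
rewrite (_ : stays _ _ _ _ _ = setT) ?indicT ?mul1e//.
by apply/seteqP; split.
Qed.

Lemma alive_facts h (D : set V) k : 0 < h -> measurable D ->
  measurable_fun setT (alive P B h D k) /\ (forall z, (0 <= alive P B h D k z)%E).
Proof.
move=> h0 mD; apply: iter_killed => //.
- exact: (measurable_bm bmB (ltW h0)).
- by apply/measurable_EFinP; exact: measurable_indic.
Qed.

Lemma alive_decr h (D : set V) k N z : 0 < h -> measurable D ->
  (alive P B h D (k + N) z <= alive P B h D N z)%E.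
Proof.
move=> h0 mD; have mB := measurable_bm bmB (ltW h0).
elim: k z => [//|k IH] z; rewrite addSn; apply: le_trans (IH z).
elim: (k + N)%N z {IH} => [|n IH] z /=.
  rewrite -[leRHS]mule1 lee_wpmul2l ?lee_fin//; apply: step_le1 => //.
  - by apply/measurable_EFinP; exact: measurable_indic.
  - by move=> y; rewrite lee_fin indicE lern1 leq_b1.
have [mn n0] := alive_facts n h0 mD; have [mn1 n10] := alive_facts n.+1 h0 mD.
by rewrite /killed lee_wpmul2l ?lee_fin//; exact: le_step.
Qed.

Lemma alive_subset h (D D' : set V) k z : 0 < h -> measurable D -> measurable D' ->
  D `<=` D' -> (alive P B h D k z <= alive P B h D' k z)%E.
Proof.
move=> h0 mD mD' DD'; have mB := measurable_bm bmB (ltW h0).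
have le1 y : (\1_D y <= \1_D' y :> R).
  rewrite !indicE ler_nat; case: (boolP (y \in D)) => //.
  by rewrite inE => /DD' Dy; rewrite mem_set.
elim: k z => [|k IH] z /=; first by rewrite lee_fin.
have [mk k0] := alive_facts k h0 mD; have [mk' k0'] := alive_facts k h0 mD'.
apply: lee_pmul => //; rewrite ?lee_fin//; first exact: step_ge0.
exact: le_step.
Qed.

(** In time [t] the walk goes from [y] to the box around [x] with the
    probability given by the Gaussian law, and the error made by forbidding
    the complement of [D] is controlled by the growing Gaussian centred at [y]:
    it is at least 1 at squared distance [rho2] up to time [t], and its value at
    the start is [sqrt 2 ^ d * exp (- rho2 / (4 * t))]. After time [t] the
    survival probability is at least [eta]. *)
Lemma local_step h k t (D : set V) N (x y : 'rV[R]_d) (delta eta rho2 : R) :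
  0 < h -> 0 < t -> h * k%:R = t -> measurable D -> 0 <= eta ->
  (forall z, box x delta z -> (eta%:E <= alive P B h D N z)%E) ->
  (forall z : 'rV[R]_d, ~ D z -> rho2 <= sqnorm (z - y)) ->
  (eta%:E * P [set w | box x delta (y + B t w)%R] <=
   alive P B h D (k + N) y +
   (eta * (Num.sqrt 2 ^+ d * expR (- rho2 / (4 * t))))%:E)%E.
Proof.
move=> h0 t0 hkt mD eta0 Heta HD.
have mB := measurable_bm bmB (ltW h0).
have mA := measurable_box x delta.
pose f (z : V) : \bar R := (\1_(box x delta : set V) z)%:E.
have mf : measurable_fun setT f.
  by apply/measurable_EFinP; exact: measurable_indic.
have f0 z : (0 <= f z)%E by rewrite lee_fin.
pose C := Num.sqrt (2 * t) ^+ d * expR (- rho2 / (4 * t)).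
have C0 : 0 <= C by rewrite mulr_ge0 ?expR_ge0 ?exprn_ge0 ?sqrtr_ge0.
(* With i steps left the growing Gaussian is taken at time u i, which goes from
   2 * t down to t at i = k; C makes it at least 1 at squared distance rho2. *)
pose u i := 2 * t - h * i%:R.
have ut i : (i <= k)%N -> t <= u i.
  move=> ik; have : h * i%:R <= t by rewrite -hkt ler_wpM2l ?(ltW h0)// ler_nat.
  by rewrite /u; lra.
have u2 i : u i <= 2 * t by rewrite /u gerBl mulr_ge0 ?(ltW h0).
pose W i (z : V) : \bar R := (C * antiheat d (u i) (sqnorm ((z : 'rV[R]_d) - y)))%:E.
have mW i : measurable_fun setT (W i).
  apply/measurable_EFinP; apply: measurable_funM => //.
  exact: (measurableT_comp (@measurable_antiheat R d (u i)) (@measurable_sqnorm R d y)).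
have W0 i z : (0 <= W i z)%E by rewrite lee_fin mulr_ge0// antiheat_ge0.
have Wstep i z : (i < k)%N -> (step P (B h) (W i) z <= W i.+1 z)%E.
  move=> ik; rewrite /step /W.
  under eq_integral do rewrite EFinM addrAC.
  have hu : h < u i.
    have : h * i.+1%:R <= t by rewrite -hkt ler_wpM2l ?(ltW h0)// ler_nat.
    by rewrite /u -addn1 natrD; lra.
  rewrite ge0_integralZl_EFin//; last 2 first.
  - by move=> w _; rewrite lee_fin antiheat_ge0.
  - apply/measurable_EFinP.
    apply: (measurableT_comp (@measurable_antiheat R d (u i))).
    have := measurableT_comp (@measurable_sqnorm R d (y - z)) mB.
    by apply: eq_measurable_fun => w _ /=; rewrite opprB addrC.
  rewrite (antiheat_step bmB)// -EFinM.
  by rewrite (_ : u i - h = u i.+1)// /u -addn1 natrD; ring.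
have W1 i z : (i <= k)%N -> ~ D z -> (1 <= W i z)%E.
  move=> ik /HD zD; rewrite lee_fin /C /antiheat.
  have ui0 : 0 < u i by apply: lt_le_trans t0 (ut i ik).
  have t20 : 0 < 2 * t by rewrite mulr_gt0.
  rewrite mulrACA -exprMn -expRD -[leLHS]mulr1 ler_pM//.
    apply: exprn_ege1; rewrite ler_pdivlMr ?sqrtr_gt0// mul1r.
    by rewrite ler_sqrt ?u2 ?(ltW t20).
  rewrite -[leLHS]expR0 ler_expR.
  have s0 := sqnorm_ge0 (z - y).
  have : sqnorm (z - y) / (4 * t) <= sqnorm (z - y) / (2 * u i).
    rewrite ler_wpM2l// lef_pV2 ?posrE ?mulr_gt0//.
    by have := u2 i; lra.
  have : rho2 / (4 * t) <= sqnorm (z - y) / (4 * t).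
    by rewrite ler_pM2r// invr_gt0 mulr_gt0.
  by rewrite mulNr; lra.
have f1 z : (f z <= 1)%E by rewrite lee_fin indicE lern1 leq_b1.
have := @comparison _ _ _ _ P (B h) mB D f f W k mD mf mf f0 f1 f0
  (fun i _ => mW i) (fun i z _ => W0 i z) Wstep W1 _ k y (leqnn k).
move=> /(_ (fun z => leeDl _ (W0 0%N z))).
rewrite iter_step_grid// hkt => H.
have Wk : W k y = (Num.sqrt 2 ^+ d * expR (- rho2 / (4 * t)))%:E.
  rewrite /W /u hkt subrr /antiheat.
  rewrite (_ : sqnorm 0 = 0); last first.
    by rewrite /sqnorm big1// => j _; rewrite mxE expr0n.
  rewrite mul0r expR0 mulr1 /C (_ : 2 * t - t = t); last by ring.
  rewrite mulrAC -exprMn sqrtrM//.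
  by rewrite -mulrA divff ?mulr1// gt_eqF// sqrtr_gt0.
have [mN N0] := alive_facts N h0 mD.
apply: (@le_trans _ _ (eta%:E * (iter k (killed P (B h) D) f y + W k y))%E).
  by rewrite lee_wpmul2l// lee_fin.
have [mk k0] := iter_killed P mB k mD mf f0.
rewrite ge0_muleDr// Wk -EFinM leeD2r//.
rewrite -(iter_killed_scale P mB)//.
rewrite /alive iterD; apply: (le_iter_killed P mB) => //.
- by apply: emeasurable_funM.
- by move=> z; rewrite mule_ge0.
move=> z; rewrite /f indicE; case: (boolP (z \in _)) => [|_].
  by rewrite inE => /Heta; rewrite mule1.
by rewrite mule0; exact: N0.
Qed.

End local_step.

(** * Points with locally uniform positive survival probability *)

Section escapable_points.
Local Open Scope ring_scope.
Context (R : realType) (d : nat) (disp : measure_display)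
  (T : measurableType disp) (P : probability T R) (B : R -> T -> 'rV[R]_d).
Hypothesis bmB : brownian_motion P B.
Hypothesis d3 : (3 <= d)%N.
Local Notation V := (g_sigma_algebraType (@box_system R d)).
Variables (c : nat -> 'rV[R]_d) (r : nat -> R).
Hypothesis r0 : forall n, 0 < r n.

Let dgt0 : (0 < d)%N. Proof. exact: ltn_trans d3. Qed.

(** Complement of the union of slightly enlarged balls. The enlargement leaves
    room for passing from grid times to all times; it is at most [r n] so that
    the potentials still dominate, and at most [kappa] so that the interior of
    the region is not affected locally. *)
Definition safe (kappa : R) : set 'rV[R]_d :=
  [set z | forall n, r n + Num.min (r n) kappa < enorm (z - c n)].

Lemma measurable_safe kappa : measurable (safe kappa : set V).
Proof.
rewrite (_ : safe kappa = \bigcap_n ((fun z : V => enorm ((z : 'rV[R]_d) - c n)) @^-1`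
    `](r n + Num.min (r n) kappa), +oo[%classic)).
  apply: bigcapT_measurable => n; rewrite -[X in measurable X]setTI.
  by apply: measurable_enorm => //; exact: measurable_itv.
apply/seteqP; split=> z /=.
  by move=> zs n _; rewrite /= in_itv/= andbT.
by move=> zs n; have := zs n I; rewrite /= in_itv/= andbT.
Qed.

Lemma safe_subset kappa kappa' : kappa <= kappa' -> safe kappa' `<=` safe kappa.
Proof.
move=> kk z zs n; apply: le_lt_trans (zs n); rewrite lerD2l.
by rewrite le_min !ge_min lexx kk orbT.
Qed.

(** Survival outside enlarged balls with a probability bounded below uniformly
    near [x], in the number of steps and in all fine enough dyadic meshes.
    Local uniformity is what makes this property both open and closed. *)
Definition escapable (x : 'rV[R]_d) := exists delta eta kappa (m0 : nat),
  [/\ 0 < delta, 0 < eta, 0 < kappa & forall m N y, (m0 <= m)%N ->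
    box x delta y -> (eta%:E <= alive P B (2^-1 ^+ m) (safe kappa) N y)%E].

Lemma pow2_gt0 m : 0 < 2^-1 ^+ m :> R.
Proof. by rewrite exprn_gt0. Qed.

Lemma pow2_small (tau : R) : 0 < tau -> exists m : nat, 2^-1 ^+ m <= tau.
Proof.
move=> tau0; exists (Num.truncn tau^-1).+1.
have q0 : 0 < tau^-1 by rewrite invr_gt0.
have /andP[_ lt] := truncn_itv (ltW q0).
rewrite exprVn -[leRHS]invrK lef_pV2 ?posrE ?invr_gt0 ?exprn_gt0//.
by apply: (le_trans (ltW lt)); rewrite -natrX ler_nat ltnW// ltn_expl.
Qed.

(** Moving a point of an enlarged ball by at most [kappa] towards the centre
    leads into the ball itself, which the box around [x] does not meet. *)
Lemma safe_compl_far x Rr kappa z : 0 < kappa -> kappa <= Rr / 2 ->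
  (forall z, box x Rr z -> forall n, r n < enorm (z - c n)) ->
  ~ safe kappa z -> exists j, Rr / 2 <= `|z ord0 j - x ord0 j|.
Proof.
move=> k0 kR xR nz; apply: contrapT => far.
have zx j : `|z ord0 j - x ord0 j| < Rr / 2.
  by rewrite ltNge; apply/negP => h; apply: far; exists j.
have Rr0 : 0 < Rr by lra.
have zbox : box x Rr z by move=> j; apply: lt_trans (zx j) _; lra.
apply: nz => n; rewrite ltNge; apply/negP => le1.
set q := enorm (z - c n) in le1.
have rq : r n < q by exact: xR.
have q0 : 0 < q by apply: lt_trans rq.
have qk : q - r n <= kappa.
  move: le1; rewrite addrC -lerBlDr => /le_trans; apply.
  by rewrite ge_min lexx orbT.
pose a := r n / q.
have a0 : 0 <= a by rewrite divr_ge0// ltW.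
pose z' := c n + a *: (z - c n).
have : r n < enorm (z' - c n).
  apply: xR => j; rewrite !mxE.
  have -> : c n ord0 j + a * (z ord0 j - c n ord0 j) - x ord0 j =
    (z ord0 j - x ord0 j) - (1 - a) * (z ord0 j - c n ord0 j) by ring.
  apply: le_lt_trans (ler_normB _ _) _.
  have : `|(1 - a) * (z ord0 j - c n ord0 j)| <= kappa.
    have a1 : 0 <= 1 - a by rewrite subr_ge0 ler_pdivrMr// mul1r ltW.
    rewrite normrM ger0_norm//.
    apply: (@le_trans _ _ ((1 - a) * q)).
      rewrite ler_wpM2l//; have := coord_le_enorm (z - c n) j.
      by rewrite !mxE.
    by rewrite mulrBl mul1r /a divfK// gt_eqF.
  by have := zx j; lra.
rewrite /z' addrAC subrr add0r enormZ// -/q /a divfK ?gt_eqF//.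
by rewrite ltxx.
Qed.

(** For small [t] the probability of reaching the small box around [x'], of
    order [exp (- d * M ^ 2 / (2 * t))], exceeds the probability of leaving the
    large box around [x], of order [exp (- Rr ^ 2 / (64 * t))]. The factor 24 in
    the distance from [x] to [x'] makes the second exponent at least twice the
    first. *)
Lemma escapable_near x x' Rr : 0 < Rr ->
  (forall z, box x Rr z -> forall n, r n < enorm (z - c n)) ->
  escapable x' -> box x (Rr / (24 * d%:R)) x' -> escapable x.
Proof.
move=> Rr0 xR [delta' [eta' [kappa' [m0 [delta0 eta0 kappa0 Hx']]]]] xx'.
have dR : 1 <= d%:R :> R by rewrite ler1n.
have dR0 : 0 < d%:R :> R by lra.
pose rho := Rr / (24 * d%:R).
have rho0 : 0 < rho by rewrite divr_gt0// mulr_gt0.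
have RrE : Rr = 24 * d%:R * rho by rewrite /rho mulrC divfK// gt_eqF// mulr_gt0.
have rho_le : rho * 24 <= Rr by rewrite RrE; nra.
pose delta := Num.min delta' rho.
have delta_gt0 : 0 < delta by rewrite lt_min delta0.
pose kappa := Num.min kappa' (Rr / 2).
have kappa_gt0 : 0 < kappa by rewrite lt_min kappa0 divr_gt0.
pose M := 3 * rho.
have M0 : 0 < M by rewrite mulr_gt0.
pose S : R := Num.sqrt 2 ^+ d.
have S0 : 0 < S by rewrite exprn_gt0// sqrtr_gt0.
(* The first bound on t is the one of gaussian_box; the second makes the
   probability of leaving the large box at most half of that of reaching the
   small one. *)
pose tau := Num.min ((2 * delta) ^+ 2 / (pi *+ 2)) (d%:R * M ^+ 2 / (4 * S)).
have pi20 : 0 < (pi *+ 2 : R) by rewrite mulrn_wgt0// pi_gt0.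
have tau0 : 0 < tau.
  rewrite lt_min; apply/andP; split; apply: divr_gt0 => //.
  - by apply: exprn_gt0; exact: mulr_gt0.
  - by apply: mulr_gt0 => //; exact: exprn_gt0.
  - exact: mulr_gt0.
have [m1 m1tau] := pow2_small tau0.
pose t : R := 2^-1 ^+ m1.
have t0 : 0 < t by exact: pow2_gt0.
have tpi : t * pi *+ 2 <= (2 * delta) ^+ 2.
  rewrite -(mulrnAr t pi 2) -ler_pdivlMr//.
  by apply: le_trans m1tau _; rewrite ge_min lexx.
have tS : t <= d%:R * M ^+ 2 / (4 * S).
  by apply: le_trans m1tau _; rewrite ge_min lexx orbT.
pose E := expR (- M ^+ 2 / (2 * t)) ^+ d.
have E0 : 0 < E by rewrite exprn_gt0// expR_gt0.
have SE : S * E <= 1 / 2.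
  have -> : E = (expR (d%:R * M ^+ 2 / (2 * t)))^-1.
    rewrite /E -expRM_natl -expRN; congr expR.
    by rewrite !mulNr mulrN mulrA.
  rewrite ler_pdivrMr ?expR_gt0//.
  apply: (@le_trans _ _ (1 / 2 * (d%:R * M ^+ 2 / (2 * t)))).
    move: tS; rewrite ler_pdivlMr ?mulr_gt0// => tS.
    rewrite mulrA ler_pdivlMr ?mulr_gt0//; lra.
  rewrite ler_wpM2l//; apply: le_trans (expR_ge1Dx _); lra.
have rhoE : expR (- (Rr ^+ 2 / 16) / (4 * t)) <= E ^+ 2.
  rewrite /E -exprM -expRM_natl ler_expR.
  have M64 : 64 * d%:R * M ^+ 2 <= Rr ^+ 2.
    rewrite RrE /M -subr_ge0.
    rewrite (_ : _ - _ = (24 * rho) ^+ 2 * d%:R * (d%:R - 1)); last by ring.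
    apply: mulr_ge0; last by rewrite subr_ge0.
    by apply: mulr_ge0; [exact: sqr_ge0|exact: ltW].
  rewrite -subr_ge0 natrM (_ : _ - _ = (Rr ^+ 2 - 64 * d%:R * M ^+ 2) / (64 * t)).
    by rewrite divr_ge0 ?subr_ge0// mulr_ge0// ltW.
  by field; rewrite gt_eqF.
exists rho, (eta' * E / 2), kappa, (maxn m0 m1); split => //.
  by rewrite !mulr_gt0.
move=> m N y; rewrite geq_max => /andP[m0m m1m] yx.
set h := 2^-1 ^+ m.
have h0 : 0 < h by exact: pow2_gt0.
pose k := (2 ^ (m - m1))%N.
have hk : h * k%:R = t.
  rewrite /h /k natrX -{1}(subnK m1m) exprD -mulrA mulrC -mulrA -exprMn.
  by rewrite divff// expr1n mulr1.
have mD := measurable_safe kappa.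
have Hbox z : box x' delta z -> (eta'%:E <= alive P B h (safe kappa) N z)%E.
  move=> zx'; apply: (@le_trans _ _ (alive P B h (safe kappa') N z)).
    apply: Hx' => // j; apply: lt_le_trans (zx' j) _.
    by rewrite ge_min lexx.
  apply: (alive_subset bmB) => //; first exact: measurable_safe.
  by apply: safe_subset; rewrite ge_min lexx.
have Hfar (z : 'rV[R]_d) : ~ safe kappa z -> Rr ^+ 2 / 16 <= sqnorm (z - y).
  move=> /(safe_compl_far kappa_gt0 _ xR)[|j jz].
    by rewrite ge_min lexx orbT.
  have zy : Rr / 4 <= `|z ord0 j - y ord0 j|.
    have := yx j; have := ler_distD (y ord0 j) (z ord0 j) (x ord0 j).
    rewrite -/rho; lra.
  rewrite -sqr_enorm (_ : Rr ^+ 2 / 16 = (Rr / 4) ^+ 2); last by field.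
  rewrite lerXn2r ?nnegrE ?enorm_ge0 ?divr_ge0 ?(ltW Rr0)//.
  apply: le_trans zy _; have := coord_le_enorm (z - y) j.
  by rewrite !mxE.
have := local_step bmB h0 t0 hk mD (ltW eta0) Hbox Hfar.
have Pbox : (E%:E <= P [set w | box x' delta (y + B t w)%R])%E.
  have := gaussian_box (bm_gaussian bmB t0) t0 delta_gt0
    (a := fun j => x' ord0 j - y ord0 j) (m := M) _ tpi.
  rewrite (_ : [set w | _] = [set w | box x' delta (y + B t w)]); last first.
    apply/seteqP; split=> w /= + j => /(_ j); rewrite mxE opprB addrCA addrA;
      by rewrite [y ord0 j + _]addrC.
  apply=> j; have := xx' j; have := yx j; rewrite -/rho.
  have := ler_distD (x ord0 j) (x' ord0 j) (y ord0 j).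
  rewrite (distrC (x ord0 j)) /M.
  have : delta <= rho by rewrite ge_min lexx orbT.
  lra.
move=> H; apply: le_trans (alive_decr bmB k N y h0 mD).
have H1 : ((eta' * E)%:E <= alive P B h (safe kappa) (k + N) y + (eta' * (E / 2))%:E)%E.
  apply: (@le_trans _ _ (eta'%:E * P [set w | box x' delta (y + B t w)%R])%E).
    by rewrite EFinM lee_wpmul2l// lee_fin ltW.
  apply: le_trans H _; rewrite leeD2l// lee_fin ler_wpM2l ?(ltW eta0)//.
  apply: (@le_trans _ _ (S * E ^+ 2)); first by rewrite ler_wpM2l ?(ltW S0).
  by rewrite expr2; nra.
rewrite (_ : eta' * E / 2 = eta' * E - eta' * (E / 2)); last by field.
by rewrite EFinB leeBlDr.
Qed.

End escapable_points.

(** * A starting point where survival is likely *)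

Section base_point.
Local Open Scope ring_scope.
Context (R : realType) (d : nat) (disp : measure_display)
  (T : measurableType disp) (P : probability T R) (B : R -> T -> 'rV[R]_d).
Hypothesis bmB : brownian_motion P B.
Hypothesis d3 : (3 <= d)%N.
Local Notation V := (g_sigma_algebraType (@box_system R d)).
Variables (c : nat -> 'rV[R]_d) (r : nat -> R).
Hypothesis r0 : forall n, 0 < r n.

Let dgt0 : (0 < d)%N. Proof. exact: ltn_trans d3. Qed.

(** Near [x] the distance to a point [a] at distance at least [rho] from [x]
    changes by a factor 2 at most. The triangle inequality is replaced by the
    inequality between squares [(u - w) ^ 2 <= 2 (v - w) ^ 2 + 2 (v - u) ^ 2]. *)
Lemma enorm_box_half (x y a : 'rV[R]_d) rho : 0 < rho -> box x (rho / (2 * d%:R)) y ->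
  rho <= enorm (x - a) -> enorm (x - a) <= 2 * enorm (y - a).
Proof.
move=> rho0 yx rhoa.
have dR : 1 <= d%:R :> R by rewrite ler1n.
have dR0 : 0 < d%:R :> R by lra.
set del := rho / (2 * d%:R) in yx.
have del0 : 0 < del by rewrite divr_gt0// mulr_gt0.
have rhoE : rho = 2 * d%:R * del by rewrite /del mulrC divfK// gt_eqF// mulr_gt0.
have syx : sqnorm (y - x) <= (rho / 2) ^+ 2.
  apply: (@le_trans _ _ (\sum_(j < d) del ^+ 2)).
    apply: ler_sum => j _; rewrite !mxE -real_normK ?num_real//.
    by rewrite lerXn2r ?nnegrE// ltW.
  rewrite sumr_const card_ord -(mulr_natl _ d) rhoE.
  rewrite -subr_ge0 (_ : _ - _ = del ^+ 2 * d%:R * (d%:R - 1)); last by field.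
  by rewrite mulr_ge0 ?subr_ge0// mulr_ge0 ?sqr_ge0// ltW.
have sxa : sqnorm (x - a) <= 2 * sqnorm (y - a) + 2 * sqnorm (y - x).
  rewrite /sqnorm !mulr_sumr -big_split/=; apply: ler_sum => j _.
  rewrite !mxE.
  move: (x ord0 j) (y ord0 j) (a ord0 j) => u v w.
  rewrite -subr_ge0 (_ : _ - _ = (u + w - 2 * v) ^+ 2); last by ring.
  exact: sqr_ge0.
have ra : rho ^+ 2 <= sqnorm (x - a).
  by rewrite -sqr_enorm lerXn2r ?nnegrE ?enorm_ge0// ltW.
rewrite -[leLHS]ger0_norm ?enorm_ge0// -[leRHS]ger0_norm; last first.
  by rewrite mulr_ge0// enorm_ge0.
rewrite -ler_sqr ?nnegrE// !real_normK ?num_real// exprMn !sqr_enorm.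
by move: syx; rewrite expr_div_n; lra.
Qed.

(** Where the series is small, the total potential is at most 1/2 in a whole
    neighbourhood, and [hitting_bound] applies there. *)
Lemma escapable_of_riesz (x : 'rV[R]_d) rho : 0 < rho ->
  (forall z, box x rho z -> forall n, r n < enorm (z - c n)) ->
  ((hit_const R d * 2 ^+ (d - 2))%:E * riesz_sum c r x <= (1 / 2)%:E)%E ->
  escapable P B c r x.
Proof.
move=> rho0 xrho Sx.
have dR : 1 <= d%:R :> R by rewrite ler1n.
have C0 := hit_const_gt0 R dgt0.
exists (rho / (2 * d%:R)), (1 / 2), 1, 0%N; split => //.
  by rewrite divr_gt0// mulr_gt0//; lra.
move=> m N y _ yx.
have rhoa n : rho <= enorm (x - c n).
  rewrite leNgt; apply/negP => lt.
  have cx : box x rho (c n).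
    move=> j; apply: le_lt_trans lt; have := coord_le_enorm (x - c n) j.
    by rewrite !mxE distrC.
  have := xrho _ cx n; rewrite subrr.
  have -> : enorm (0 : 'rV[R]_d) = 0.
    by rewrite /enorm big1 ?sqrtr0// => j _; rewrite mxE expr0n.
  by rewrite ltNge ltW.
have xa0 n : 0 < enorm (x - c n) by apply: lt_le_trans (rhoa n).
have half n : enorm (x - c n) <= 2 * enorm (y - c n).
  exact: (enorm_box_half rho0 yx (rhoa n)).
have ya0 n : 0 < enorm (y - c n) by have := half n; have := xa0 n; lra.
have h0 := pow2_gt0 R m.
have Dc z : ~ safe c r 1 z -> exists n, enorm (z - c n) <= 2 * r n.
  move=> nz; apply: contrapT => nex; apply: nz => n; rewrite ltNge; apply/negP => le.
  apply: nex; exists n; apply: le_trans le _.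
  by rewrite mulr_natl mulr2n lerD2l ge_min lexx.
have H := hitting_bound bmB d3 r0 h0 N y (measurable_safe c r 1) Dc.
have : (total_pot c r (2^-1 ^+ m) y <= (1 / 2)%:E)%E.
  apply: le_trans (total_pot_le d3 r0 h0 ya0) _.
  apply: le_trans Sx; rewrite (EFinM (hit_const R d)) -(muleA (hit_const R d)%:E).
  apply: lee_wpmul2l.
    by rewrite lee_fin ltW.
  have t0 (z : 'rV[R]_d) n : 0 <= (r n / enorm (z - c n)) ^+ (d - 2).
    by rewrite exprn_ge0// divr_ge0 ?enorm_ge0// ltW.
  rewrite /riesz_sum -nneseriesZl; last by move=> n _; rewrite lee_fin t0.
  apply: lee_nneseries => n _; first by move=> _; rewrite lee_fin t0.
  rewrite -EFinM lee_fin -exprMn lerXn2r ?nnegrE ?divr_ge0 ?enorm_ge0 ?(ltW (r0 n))//.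
    by rewrite mulr_ge0// divr_ge0 ?enorm_ge0 ?(ltW (r0 n)).
  rewrite mulrCA ler_wpM2l ?(ltW (r0 n))//.
  by rewrite -[leLHS]div1r ler_pdivrMr// mulrAC ler_pdivlMr// mul1r.
move=> H2; have := le_trans H (leeD2l _ H2).
rewrite -leeBlDr// -EFinB => H3; apply: le_trans H3.
by rewrite lee_fin; lra.
Qed.

Lemma prob_coord_small t rho j : 0 < t -> 0 < rho -> (8 * rho) ^+ 2 <= t ->
  (P [set w | (`|B t w ord0 j| < rho)%R] <= (1 / 4)%:E)%E.
Proof.
move=> t0 rho0 rhot.
have st0 : Num.sqrt t != 0 by rewrite gt_eqF ?sqrtr_gt0.
rewrite (_ : [set w | _] =
    [set w | (`](- rho)%R, rho[%classic : set R) (B t w ord0 j)]); last first.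
  by apply/seteqP; split=> w /=; rewrite in_itv/= ltr_norml.
rewrite (@gaussian_coord _ _ _ _ _ (Num.sqrt t) _ (bm_gaussian bmB t0));
  last exact: measurable_itv.
apply: (@le_trans _ _
  (\int[lebesgue_measure]_(x in `](- rho)%R, rho[) (cst (normal_peak (Num.sqrt t))%:E x))%E).
  apply: ge0_le_integral => //.
  - by move=> x _; rewrite lee_fin normal_pdf_ge0.
  - apply/measurable_EFinP; apply: measurable_funTS; exact: measurable_normal_pdf.
  - by move=> x _; rewrite lee_fin normal_pdf_ub.
rewrite integral_cst//= lebesgue_measure_itv/= lte_fin.
rewrite (_ : - rho < rho); last by lra.
rewrite -EFinD -EFinM lee_fin /normal_peak sqr_sqrtr ?(ltW t0)//.
have : 8 * rho <= Num.sqrt (t * pi *+ 2).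
  rewrite -[leLHS]ger0_norm ?mulr_ge0 ?(ltW rho0)// -sqrtr_sqr ler_wsqrtr//.
  apply: (le_trans rhot); rewrite -(mulrnAr t pi 2) ler_peMr ?(ltW t0)//.
  by have := pi_ge2 R; move: (@pi R) => p p2; rewrite mulr2n; lra.
move: (Num.sqrt _) => s s8; rewrite ler_pdivrMl; lra.
Qed.

(** Finitely many balls are invisible from far away. *)
Lemma far_terms_small (N : nat) (eps : R) : 0 < eps -> exists2 rho : R, 0 < rho &
  forall (z : 'rV[R]_d) j, rho <= `|z ord0 j| -> forall n, (n < N)%N ->
    2 * r n < enorm (z - c n) /\ (r n / enorm (z - c n)) ^+ (d - 2) <= eps.
Proof.
move=> eps0; (* A distance at least r n * L makes the ratio at most 1/L <= min 1 eps, hence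
   also its powers. *)
pose L : R := Num.max 1 eps^-1.
have L1 : 1 <= L by rewrite le_max lexx.
have L0 : 0 < L by apply: lt_le_trans L1.
pose b n : R := enorm (c n) + 2 * r n + 1 + r n * L.
have b0 n : 0 < b n.
  rewrite /b ltr_wpDr ?mulr_ge0 ?(ltW (r0 n)) ?(ltW L0)// ltr_wpDl//.
  by rewrite addr_ge0 ?enorm_ge0// mulr_ge0// ltW.
exists (1 + \sum_(n < N) b n).
  by rewrite ltr_wpDr// sumr_ge0// => n _; exact: ltW.
move=> z j zj n nN.
have bn : b n <= \sum_(n < N) b n.
  rewrite (bigD1 (Ordinal nN))//= lerDl sumr_ge0// => i _; exact: ltW.
have zc : 2 * r n + 1 + r n * L <= enorm (z - c n).
  apply: (@le_trans _ _ `|(z - c n) ord0 j|); last exact: coord_le_enorm.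
  rewrite !mxE; apply: (@le_trans _ _ (`|z ord0 j| - `|c n ord0 j|)); last exact: lerB_dist.
  have := coord_le_enorm (c n) j; move: bn; rewrite /b; lra.
have rL : 0 < r n * L by rewrite mulr_gt0.
have z0 : 0 < enorm (z - c n) by apply: lt_le_trans zc; have := r0 n; lra.
split; first by lra.
have q0 : 0 <= r n / enorm (z - c n) by rewrite divr_ge0 ?ltW.
have q1 : r n / enorm (z - c n) <= L^-1.
  rewrite ler_pdivrMr// mulrC ler_pdivlMr//; have := r0 n; lra.
have Li : L^-1 <= 1 by rewrite invf_le1.
apply: (@le_trans _ _ (r n / enorm (z - c n))).
  rewrite -[leRHS]expr1 ler_wiXn2l// ?subn_gt0//.
  exact: le_trans Li.
apply: (le_trans q1); rewrite -[leRHS]invrK lef_pV2 ?posrE ?invr_gt0//.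
by rewrite le_max lexx orbT.
Qed.

End base_point.

Section base_point_existence.
Local Open Scope ring_scope.
Context (R : realType) (d : nat) (disp : measure_display)
  (T : measurableType disp) (P : probability T R) (B : R -> T -> 'rV[R]_d).
Hypothesis bmB : brownian_motion P B.
Hypothesis d3 : (3 <= d)%N.
Local Notation V := (g_sigma_algebraType (@box_system R d)).

Lemma nneseries_tail_small (f : nat -> \bar R) (eps : R) : 0 < eps ->
  (forall k, 0 <= f k)%E -> (\sum_(0 <= k <oo) f k < +oo)%E ->
  exists N, (\sum_(N <= k <oo) f k < eps%:E)%E.
Proof.
move=> eps0 f0 foo; apply: contrapT => no.
have cv := nneseries_tail_cvg foo (fun k _ => f0 k).
have : (eps%:E <= limn (fun N => \sum_(N <= k <oo) f k))%E.
  apply: lime_ge; first by apply/cvg_ex; exists 0%E.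
  by apply: nearW => N; rewrite leNgt; apply/negP => lt; apply: no; exists N.
by rewrite (cvg_lim _ cv)// lee_fin leNgt eps0.
Qed.

Lemma riesz_term_ge0 (c : nat -> 'rV[R]_d) (r : nat -> R) z n : (forall n, 0 < r n) ->
  0 <= (r n / enorm (z - c n)) ^+ (d - 2).
Proof. by move=> r0; rewrite exprn_ge0// divr_ge0 ?enorm_ge0// ltW. Qed.

Lemma riesz_sum_split (c : nat -> 'rV[R]_d) (r : nat -> R) N z : (forall n, 0 < r n) ->
  riesz_sum c r z = (\sum_(0 <= n < N) ((r n / enorm (z - c n)) ^+ (d - 2))%:E +
    riesz_sum (fun n => c (n + N)%N) (fun n => r (n + N)%N) z)%E.
Proof.
move=> r0.
rewrite /riesz_sum (nneseries_split 0%N N)/=; last first.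
  by move=> k _; rewrite lee_fin riesz_term_ge0.
rewrite add0n; congr (_ + _)%E.
pose f n := ((r n / enorm (z - c n)) ^+ (d - 2))%:E.
rewrite -(@nneseries_addn R f N)// => n; by rewrite lee_fin riesz_term_ge0.
Qed.

Lemma riesz_le_total_pot (c : nat -> 'rV[R]_d) (r : nat -> R) t z :
  (forall n, 0 < r n) -> 0 < t -> (forall n, 2 * r n < enorm (z - c n)) ->
  (riesz_sum c r z <= total_pot c r t z)%E.
Proof.
move=> r0 t0 zc; apply: lee_nneseries => n _.
  by move=> _; rewrite lee_fin riesz_term_ge0.
have rn := r0 n; have zn := zc n.
have e0 : 0 < enorm (z - c n) by lra.
apply: pot_ge => //.
- exact: ltnW.
- exact: ltW.
- exact: mesh_gt0.
- apply: (le_trans (mesh_le t0 rn)).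
  rewrite lerXn2r ?nnegrE ?(ltW rn) ?(ltW e0)//; lra.
- lra.
Qed.

Variables (c : nat -> 'rV[R]_d) (r : nat -> R).
Hypothesis r0 : forall n, 0 < r n.

(** The potential of the tail of the series is small at 0, and its mean under
    the law of [B t] is not larger. For large [t] the vector [B t] is also far
    from the origin with high probability, where the first [N] balls do not
    matter. Both events occur together for some sample point [w], and [B t w] is
    the point sought. *)
Lemma exists_small_riesz eps : 0 < eps ->
  (forall n, 0 < enorm (0 - c n)) -> (riesz_sum c r 0 < +oo)%E ->
  exists x, (forall n, 2 * r n < enorm (x - c n)) /\ (riesz_sum c r x <= eps%:E)%E.
Proof.
move=> eps0 c0 Soo.
have dgt0 : (0 < d)%N by exact: ltn_trans d3.
pose j0 := Ordinal dgt0.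
pose C := hit_const R d; have C0 : 0 < C by exact: hit_const_gt0.
pose e := Num.min eps 1.
have e0 : 0 < e by rewrite lt_min eps0 ltr01.
have e1 : e <= 1 by rewrite ge_min lexx orbT.
have [N Ntail] : exists N,
    (\sum_(N <= k <oo) ((r k / enorm (0 - c k)) ^+ (d - 2))%:E < (e / (4 * C))%:E)%E.
  apply: nneseries_tail_small => //; first by rewrite divr_gt0// mulr_gt0.
  by move=> k; rewrite lee_fin riesz_term_ge0.
pose c' n := c (n + N)%N; pose r' n := r (n + N)%N.
have r0' n : 0 < r' n by exact: r0.
have S' : (riesz_sum c' r' 0 <= (e / (4 * C))%:E)%E.
  pose f n := ((r n / enorm (0 - c n)) ^+ (d - 2))%:E.
  rewrite -[leLHS]/(\sum_(0 <= i <oo) f (i + N)%N)%E nneseries_addn ?(ltW Ntail)//.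
  by move=> n; rewrite lee_fin riesz_term_ge0.
have [rho rho0 Hrho] := @far_terms_small R d d3 c r r0 N (e / (2 * N.+1%:R))
  (divr_gt0 e0 (mulr_gt0 (ltr0Sn _ _) (ltr0Sn _ _))).
(* Late enough for a coordinate of B t to be smaller than rho in absolute value
   with probability at most 1/4. *)
pose t := (8 * rho) ^+ 2.
have t0 : 0 < t by rewrite exprn_gt0// mulr_gt0.
pose U := total_pot c' r' t.
have mU : measurable_fun setT (U : V -> \bar R) by exact: measurable_total_pot.
have U0 z : (0 <= U z)%E by exact: total_pot_ge0.
have mB := measurable_bm bmB (ltW t0).
have mUB : measurable_fun setT (fun w => U (B t w)) by exact: (measurableT_comp mU mB).
have IU : (\int[P]_w U (B t w) <= (e / 4)%:E)%E.
  have -> : (\int[P]_w U (B t w))%E = step P (B t) U (0 : 'rV[R]_d).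
    by apply: eq_integral => w _; congr (U _); rewrite add0r.
  apply: le_trans (total_pot_step bmB c' r0' t0 0) _.
  apply: le_trans (total_pot_le d3 r0' t0 (fun n => c0 (n + N)%N)) _.
  apply: le_trans (lee_wpmul2l _ S') _; first by rewrite lee_fin ltW.
  by rewrite -EFinM lee_fin -/C le_eqVlt; apply/orP; left; apply/eqP; field; rewrite gt_eqF.
have [w [w1 w2]] : exists w, rho <= `|B t w ord0 j0| /\ (U (B t w) < (e / 2)%:E)%E.
  apply: contrapT => no.
  pose A := [set w | (`|B t w ord0 j0| < rho)%R].
  have mA : measurable A.
    rewrite (_ : A = (fun w => B t w ord0 j0) @^-1` (`]- rho, rho[%classic : set R)).
      rewrite -[X in measurable X]setTI.
      by apply: (@measurable_vec_coord R d _ T (B t) j0) => //; exact: measurable_itv.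
    by apply/seteqP; split=> w /=; rewrite /A /= in_itv/= ltr_norml.
  have PA : (P A <= (1 / 4)%:E)%E by apply: (prob_coord_small bmB) => //.
  (* If no sample point works, then the following inequality holds everywhere,
     and its integral reads 1 <= 1/4 + 1/2. *)
  have le1 w : (1 <= (\1_A w)%:E + (2 / e)%:E * U (B t w))%E.
    have [Aw|nAw] := pselect (A w).
      by rewrite indicE mem_set// leeDl// mule_ge0// lee_fin divr_ge0// ltW.
    rewrite indicE memNset// add0e.
    have Uw : ((e / 2)%:E <= U (B t w))%E.
      rewrite leNgt; apply/negP => lt; apply: no; exists w; split => //.
      by rewrite leNgt; apply/negP.
    apply: le_trans (lee_wpmul2l _ Uw); last by rewrite lee_fin divr_ge0// ltW.
    by rewrite -EFinM lee_fin mulrA divfK ?gt_eqF// divff.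
  have : (\int[P]_w (cst 1 w) <= \int[P]_w ((\1_A w)%:E + (2 / e)%:E * U (B t w)))%E.
    apply: ge0_le_integral => //.
    apply: emeasurable_funD; first by apply/measurable_EFinP; exact: measurable_indic.
    exact: emeasurable_funM.
  have -> : (\int[P]_w (cst 1 w) = 1)%E.
    by rewrite integral_cst// mul1e; exact: probability_setT.
  rewrite ge0_integralD//; last 3 first.
  - by apply/measurable_EFinP; exact: measurable_indic.
  - by move=> w _; rewrite mule_ge0// lee_fin divr_ge0// ltW.
  - exact: emeasurable_funM.
  rewrite integral_indic// setIT ge0_integralZl_EFin//; last first.
    by rewrite divr_ge0// ltW.
  move=> H; have : (1%:E <= (1 / 4)%:E + (2 / e)%:E * (e / 4)%:E)%E.
    apply: le_trans H _; apply: leeD => //; apply: lee_wpmul2l => //.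
    by rewrite lee_fin divr_ge0// ltW.
  rewrite -EFinM -EFinD lee_fin.
  rewrite (_ : 2 / e * (e / 4) = 1 / 2); last by field; rewrite gt_eqF.
  lra.
exists (B t w).
have far n : 2 * r n < enorm (B t w - c n).
  have [nN|Nn] := ltnP n N; first by have [] := Hrho _ _ w1 n nN.
  rewrite ltNge; apply/negP => le.
  have := @total_pot_ge1 R d d3 c' r' t r0' t0 (n - N)%N (B t w).
  rewrite /c' /r' subnK// => /(_ le) /le_lt_trans /(_ w2).
  by rewrite lte_fin; lra.
split => //.
rewrite (riesz_sum_split c N)//.
have tailx : (riesz_sum c' r' (B t w) <= (e / 2)%:E)%E.
  apply: le_trans (ltW w2); apply: riesz_le_total_pot => // n.
  exact: far.
have headx : (\sum_(0 <= n < N) ((r n / enorm (B t w - c n)) ^+ (d - 2))%:E <= (e / 2)%:E)%E.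
  rewrite sumEFin lee_fin big_nat.
  apply: (@le_trans _ _ (\sum_(0 <= n < N) e / (2 * N.+1%:R))).
    rewrite [leRHS]big_nat; apply: ler_sum => n /andP[_ nN].
    by have [] := Hrho _ _ w1 n nN.
  rewrite sumr_const_nat subn0 -(mulr_natr _ N).
  rewrite mulrAC ler_pdivrMr ?mulr_gt0//.
  rewrite -subr_ge0 -(addn1 N) natrD.
  rewrite (_ : _ - _ = e); last by field.
  exact: ltW.
apply: le_trans (leeD headx tailx) _; rewrite -EFinD lee_fin -splitr.
by rewrite ge_min lexx.
Qed.

End base_point_existence.

(** * Connectedness, and passage from the grid to the path *)

Section boxes.
Local Open Scope ring_scope.
Context (R : realType) (d : nat).
Implicit Types x y z : 'rV[R]_d.

Lemma nbhs_box x (e : R) : 0 < e -> nbhs x (box x e).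
Proof.
move=> e0; apply/nbhs_ballP; exists e => //= y xy j.
by have [_ xy'] := xy; rewrite distrC; exact: (xy' ord0 j).
Qed.

Lemma open_box (U : set 'rV[R]_d) x : open U -> U x ->
  exists2 e : R, 0 < e & box x e `<=` U.
Proof.
move=> oU Ux; have /nbhs_ballP[e /= e0 eU] := open_nbhs_nbhs (conj oU Ux).
exists e => // y xy; apply: eU; split=> // i j; rewrite [i]ord1.
by rewrite /ball/= distrC; exact: xy.
Qed.

Lemma continuous_enorm (a : 'rV[R]_d) : continuous (fun z : 'rV[R]_d => enorm (z - a)).
Proof.
have csqr j : continuous (fun z : 'rV[R]_d => (z ord0 j - a ord0 j) ^+ 2).
  move=> z; apply: (@continuous_comp _ _ _ (fun z : 'rV[R]_d => z ord0 j)
    (fun u : R => (u - a ord0 j) ^+ 2)); first exact: coord_continuous.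
  apply: (@continuous_comp _ _ _ (fun u : R => u - a ord0 j) (fun u : R => u ^+ 2)).
    by apply: (@cvgB _ R^o) => //; exact: cvg_cst.
  exact: sqr_continuous.
have csum : continuous (fun z : 'rV[R]_d => \sum_(j < d) (z ord0 j - a ord0 j) ^+ 2).
  by apply: continuous_big => //; exact: add_continuous.
rewrite (_ : (fun z => _) = fun z : 'rV[R]_d =>
    Num.sqrt (\sum_(j < d) (z ord0 j - a ord0 j) ^+ 2)).
  by move=> z; apply: continuous_comp; [exact: csum|exact: sqrt_continuous].
apply/funext => z; congr Num.sqrt; apply: eq_bigr => j _.
by rewrite !mxE.
Qed.

End boxes.

Section paths.
Local Open Scope ring_scope.
Context (R : realType) (d : nat).
Variable X : R -> 'rV[R]_d.
Hypothesis cX : {within `[0, +oo[, continuous X}.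

Lemma continuous_distance (a : 'rV[R]_d) :
  {within `[0, +oo[, continuous (fun t => enorm (X t - a))}.
Proof.
move=> t; apply: (@continuous_comp (subspace (`[0, +oo[%classic : set R)) _ _ X
  (fun z => enorm (z - a))); [exact: cX|exact: continuous_enorm].
Qed.

(** An open condition on the position that holds at time [t] holds at a dyadic
    time just after [t], for every fine enough mesh. *)
Lemma dyadic_hit (a : 'rV[R]_d) t v : 0 <= t -> enorm (X t - a) < v ->
  exists m1, forall m, (m1 <= m)%N -> exists i : nat,
    [/\ (i <= m * 2 ^ m)%N, 2^-1 ^+ m * i%:R <= t + 1 &
        enorm (X (2^-1 ^+ m * i%:R) - a) < v].
Proof.
move=> t0 tv.
have /subspace_continuousP cd := @continuous_distance a.
have t_itv : `[0, +oo[%classic t by rewrite /= in_itv/= t0.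
have nv : nbhs t (fun s => `[0, +oo[%classic s -> enorm (X s - a) < v).
  exact: (@cvgr_lt _ _ _ _ _ _ (cd t t_itv) _ tv).
have [e /= e0 He] := (nbhs_ballP _ _).1 nv.
have [m2 m2e] := pow2_small e0.
have [k kt] : exists k : nat, t + 1 <= k%:R.
  exists (Num.truncn (t + 1)).+1.
  by have /andP[_ /ltW] := truncn_itv (addr_ge0 t0 ler01).
exists (maxn m2.+1 k) => m; rewrite geq_max => /andP[m2m km].
set h := 2^-1 ^+ m.
have h0 : 0 < h by exact: pow2_gt0.
have h1 : h <= 1 by rewrite exprn_ile1 ?invr_ge0// invf_le1// ler1n.
have he : h < e.
  apply: lt_le_trans m2e; rewrite /h ltr_iXn2l//.
  by rewrite invf_lt1// ltr1n.
have q0 : 0 <= t / h by rewrite divr_ge0// ltW.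
have /andP[i1 i2] := truncn_itv q0.
set i := (Num.truncn (t / h)).+1.
have t1 : t < h * i%:R by rewrite mulrC -ltr_pdivrMr.
have t2 : h * i%:R <= t + h.
  rewrite /i -addn1 natrD mulrDr mulr1 lerD2r.
  by rewrite mulrC -ler_pdivlMr.
exists i; split.
- have hm : h * (m * 2 ^ m)%:R = m%:R.
    rewrite natrM natrX mulrCA /h -exprMn mulVf ?pnatr_eq0// expr1n mulr1//.
  rewrite -(@ler_nat R) -(ler_pM2l h0) hm.
  apply: (@le_trans _ _ (t + 1)); first lra.
  by apply: (le_trans kt); rewrite ler_nat.
- lra.
- apply: He; last by rewrite /= in_itv/= andbT; lra.
  by rewrite /ball/= ltr_norml; lra.
Qed.

(** On each compact time interval the distance attains its minimum, which turns
    a statement about all times into one about countably many times. *)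
Lemma path_avoids_ballP (a : 'rV[R]_d) (v : R) :
  (forall t, 0 <= t -> v < enorm (X t - a)) <->
  (forall K : nat, exists m : nat, forall j i : nat,
      2^-1 ^+ j * i%:R <= K%:R :> R ->
    v + m.+1%:R^-1 <= enorm (X (2^-1 ^+ j * i%:R) - a)).
Proof.
split=> [avoid K|H t t0].
  have K0 : 0 <= K%:R :> R by [].
  have cK : {within `[0, K%:R], continuous (fun t => enorm (X t - a))}.
    apply: continuous_subspaceW (@continuous_distance a) => t /=.
    by rewrite !in_itv/= andbT => /andP[].
  have [s sK smin] := EVT_min K0 cK.
  have s0 : 0 <= s by move: sK; rewrite in_itv/= => /andP[].
  have vs := avoid s s0.
  exists (Num.truncn (enorm (X s - a) - v)^-1) => j i ijK.
  have q0 : 0 < enorm (X s - a) - v by rewrite subr_gt0.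
  apply: (@le_trans _ _ (enorm (X s - a))); last first.
    by apply: smin; rewrite in_itv/= ijK mulr_ge0// ltW// pow2_gt0.
  have q1 : 0 < (enorm (X s - a) - v)^-1 by rewrite invr_gt0.
  have /andP[_ /ltW le] := truncn_itv (ltW q1).
  by rewrite -lerBrDl -[leRHS]invrK lef_pV2 ?posrE.
have [K Kt] : exists K : nat, t + 1 <= K%:R.
  exists (Num.truncn (t + 1)).+1.
  by have /andP[_ /ltW] := truncn_itv (addr_ge0 t0 ler01).
have [m Hm] := H K.
rewrite ltNge; apply/negP => le.
have : enorm (X t - a) < v + m.+1%:R^-1.
  by apply: (le_lt_trans le); rewrite ltrDl invr_gt0.
move=> /(dyadic_hit t0)[m1 /(_ m1 (leqnn _))[i [_ it]]].
by rewrite ltNge Hm// (le_trans it).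
Qed.

End paths.

Section conclusion.
Local Open Scope ring_scope.
Context (R : realType) (d : nat) (disp : measure_display)
  (T : measurableType disp) (P : probability T R) (B : R -> T -> 'rV[R]_d).
Hypothesis bmB : brownian_motion P B.
Hypothesis d3 : (3 <= d)%N.
Local Notation V := (g_sigma_algebraType (@box_system R d)).
Variables (c : nat -> 'rV[R]_d) (r : nat -> R).
Hypothesis r0 : forall n, 0 < r n.

Definition avoid_event : set T := [set w | forall t : R, 0 <= t ->
  forall n, ~ closed_eball (c n) (r n) (B t w)].

(** By [path_avoids_ballP] the event is built by countable operations from
    conditions on the positions at dyadic times. *)
Lemma measurable_avoid_event : measurable avoid_event.
Proof.
pose E n K m j i : set T := if 2^-1 ^+ j * i%:R <= K%:R :> R then
  [set w | r n + m.+1%:R^-1 <= enorm (B (2^-1 ^+ j * i%:R) w - c n)] else setT.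
have -> : avoid_event =
    \bigcap_n \bigcap_K \bigcup_m \bigcap_j \bigcap_i E n K m j i.
  apply/seteqP; split=> w /=.
    move=> av n _ K _.
    have : forall t, 0 <= t -> r n < enorm (B t w - c n).
      by move=> t t0; rewrite ltNge; apply/negP; exact: av.
    move=> /(path_avoids_ballP (@bm_continuous _ _ _ _ _ _ bmB w))/(_ K)[m Hm].
    by exists m => // j _ i _; rewrite /E; case: ifPn => // /Hm.
  move=> H t t0 n; apply/negP; rewrite -ltNge; move: t t0.
  apply/(path_avoids_ballP (@bm_continuous _ _ _ _ _ _ bmB w)) => K.
  have [m _ Hm] := H n I K I; exists m => j i ji.
  by have := Hm j I i I; rewrite /E ji.
apply: bigcapT_measurable => n; apply: bigcapT_measurable => K.
apply: bigcupT_measurable => m; apply: bigcapT_measurable => j.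
apply: bigcapT_measurable => i; rewrite /E; case: ifPn => // _.
have t0 : 0 <= 2^-1 ^+ j * i%:R :> R by rewrite mulr_ge0// ltW// pow2_gt0.
have mB := measurable_bm bmB t0.
have me := measurableT_comp (@measurable_enorm R d (c n)) mB.
have := me measurableT `[r n + m.+1%:R^-1, +oo[%classic (measurable_itv _).
rewrite setTI; congr (measurable _).
by apply/seteqP; split=> w /=; rewrite in_itv/= andbT.
Qed.

(** Staying safe at the times of mesh [2 ^ (- m)] up to time [m] is a decreasing
    sequence of events of probability at least [eta]; on their intersection, a
    hit of a closed ball would be seen at a nearby dyadic time as a visit to
    the enlarged ball. *)
Lemma avoid_of_escapable : escapable P B c r 0 -> (0 < P avoid_event)%E.
Proof.
move=> [delta [eta [kappa [m0 [delta0 eta0 kappa0 H]]]]].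
apply: (@lt_le_trans _ _ eta%:E); first by rewrite lte_fin.
pose h m : R := 2^-1 ^+ m.
have hgt0 m : 0 < h m by exact: pow2_gt0.
have mS := measurable_safe c r kappa.
pose F m : set T := stays B (h (m + m0)%N) (safe c r kappa) 0 ((m + m0) * 2 ^ (m + m0)).
have mF m : measurable (F m) by exact: (measurable_stays bmB).
have mI : measurable (\bigcap_n F n) by exact: bigcapT_measurable.
have PF m : (eta%:E <= P (F m))%E.
  have mcst : measurable_fun setT (fun=> 1%E : \bar R) by [].
  have := grid_markov bmB (hgt0 (m + m0)%N) 0 ((m + m0) * 2 ^ (m + m0)) mS
    (f := fun=> 1%E) (measurable_cst _) (fun=> lee01).
  under eq_integral do rewrite mule1.
  rewrite integral_indic ?setIT//; last exact: mF.
  move=> ->; rewrite (_ : (fun z => _) = (fun z => (\1_(safe c r kappa) z)%:E)); last first.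
    by apply/funext => z; rewrite mule1.
  apply: H; first exact: leq_addl.
  by move=> j; rewrite subrr normr0.
have ndF : nonincreasing_seq F.
  apply/nonincreasing_seqP => m; apply/subsetPset => w /= S i im.
  have := S (i * 2)%N; rewrite addSn expnS.
  have -> : h (m + m0).+1 * (i * 2)%:R = h (m + m0)%N * i%:R.
    by rewrite /h exprS natrM; field.
  apply; rewrite mulnCA mulnC leq_mul2l/=.
  by apply: (leq_trans im); rewrite leq_mul2r leqnSn orbT.
have F0oo : (P (F 0%N) < +oo)%E.
  by apply: (le_lt_trans (probability_le1 P (mF 0%N))); exact: ltry.
have cv := nonincreasing_cvg_mu F0oo mF mI ndF.
have PI : (eta%:E <= P (\bigcap_n F n))%E.
  rewrite -(cvg_lim _ cv)//; apply: lime_ge; first by apply/cvg_ex; eexists; exact: cv.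
  by apply: nearW => m; exact: PF.
apply: (le_trans PI); apply: le_measure; rewrite ?inE//.
  exact: measurable_avoid_event.
move=> w Fw t t0 n /= hit.
have lt : enorm (B t w - c n) < r n + Num.min (r n) kappa.
  by apply: (le_lt_trans hit); rewrite ltrDl lt_min r0.
have [m1 Hm1] := dyadic_hit (@bm_continuous _ _ _ _ _ _ bmB w) t0 lt.
have [i [im _]] := Hm1 (m1 + m0)%N (leq_addr _ _).
have := Fw m1 I i im n; rewrite add0r => /lt_trans/[apply].
by rewrite ltxx.
Qed.

(** The escapable points of the region form an open set, which is closed in the
    region by [escapable_near] because there the radius that works depends only on
    the limit point. *)
Lemma region_escapable (Omega : set 'rV[R]_d) :
  Omega = [set z | forall n, r n < enorm (z - c n)] -> open Omega -> connected Omega ->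
  (exists2 x, Omega x & escapable P B c r x) -> Omega `<=` escapable P B c r.
Proof.
move=> OmegaE oO cO [x0 Ox0 gx0].
pose W := [set x | Omega x /\ escapable P B c r x].
suff -> : Omega = W by move=> x [].
apply/esym; apply: cO; first by exists x0.
- exists W; last by apply/seteqP; split=> [x [Ox gx]|x []].
  rewrite openE => x [Ox [delta [eta [kappa [m0 [delta0 eta0 kappa0 H]]]]]].
  have : nbhs x (Omega `&` box x (delta / 2)).
    apply: filterI; first exact: open_nbhs_nbhs.
    by apply: nbhs_box; rewrite divr_gt0.
  apply: filterS => y [Oy xy]; split => //.
  exists (delta / 2), eta, kappa, m0; split => //; first by rewrite divr_gt0.
  move=> m N z m0m yz; apply: H => // j.
  have := xy j; have := yz j.
  have := ler_distD (y ord0 j) (z ord0 j) (x ord0 j); lra.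
- exists (closure W); first exact: closed_closure.
  apply/seteqP; split=> [x Wx|x [Ox clx]].
    by split; [by case: Wx|exact: subset_closure].
  split => //.
  have [e e0 eO] := open_box oO Ox.
  have d0 : (0 : R) < 24 * d%:R.
    by rewrite mulr_gt0// ltr0n (ltn_trans _ d3).
  have [y [[Oy gy] xy]] := clx _ (nbhs_box x (divr_gt0 e0 d0)).
  apply: (escapable_near bmB d3 r0 e0 _ gy xy) => z /eO.
  by rewrite OmegaE.
Qed.

End conclusion.

Theorem proposition1 (R : realType) (d : nat) (c : nat -> 'rV[R]_d)
    (r : nat -> R) (Omega : set 'rV[R]_d) :
  (3 <= d)%N ->
  (forall n, 0 < r n) ->
  trivIset setT (fun n => closed_eball (c n) (r n)) ->
  Omega = ~` (\bigcup_n closed_eball (c n) (r n)) ->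
  region Omega ->
  Omega 0 ->
  (\sum_(0 <= n <oo) ((r n / enorm (c n)) ^+ (d - 2)%N)%R%:E < +oo)%E ->
  avoidable c r.
Proof.
move=> d3 r0 _ OmegaC [oO cO] O0 sum_lt disp T P B bmB.
have OmegaE : Omega = [set z | forall n, r n < enorm (z - c n)].
  rewrite OmegaC; apply/seteqP; split=> [z nz n|z zc [n _ /= zn]].
    by rewrite ltNge; apply/negP => zn; apply: nz; exists n.
  by have := zc n; rewrite ltNge zn.
have enormN n : enorm (0 - c n) = enorm (c n).
  rewrite /enorm; congr Num.sqrt; apply: eq_bigr => j _.
  by rewrite sub0r mxE sqrrN.
have c0 n : 0 < enorm (0 - c n).
  by move: O0; rewrite OmegaE => /(_ n); exact: lt_trans.
have S0 : (riesz_sum c r 0 < +oo)%E.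
  by rewrite /riesz_sum; under eq_eseriesr do rewrite enormN.
have C0 : 0 < hit_const R d * 2 ^+ (d - 2).
  by rewrite mulr_gt0 ?exprn_gt0// hit_const_gt0// (ltn_trans _ d3).
pose eps := 1 / 2 / (hit_const R d * 2 ^+ (d - 2)).
have eps0 : 0 < eps by rewrite divr_gt0.
have [x [xfar xsum]] := exists_small_riesz bmB d3 r0 eps0 c0 S0.
have Ox : Omega x.
  by rewrite OmegaE => n; have := r0 n; have := xfar n; lra.
have [rho rho0 rhoO] := open_box oO Ox.
have gx : escapable P B c r x.
  apply: (escapable_of_riesz bmB d3 r0 rho0).
    by move=> z /rhoO; rewrite OmegaE.
  apply: (@le_trans _ _ ((hit_const R d * 2 ^+ (d - 2))%:E * eps%:E)%E).
    by rewrite lee_wpmul2l// lee_fin ltW.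
  by rewrite -EFinM lee_fin /eps mulrC divfK// gt_eqF.
apply: (avoid_of_escapable bmB r0).
by apply: (region_escapable bmB d3 r0 OmegaE oO cO) O0; exists x.
Qed.
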